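(* Let $2\le n<\infty$. (i) Let $m=(n-1)k+1$ with $k\ge 2$ and let $z=(z_1,\ldots,z_m)\in(\mathbb{C}^m)_1$. The geometric progression state on $\mathcal{O}_n$ by $z$ (of order $k$) is unique if and only if $|z_m|<1$. In this case, this unique state is pure. (ii) For any $z\in\ell^2_1$, the geometric progression state on $\mathcal{O}_n$ by $z$ (of order $\infty$) is unique and pure.
   Context: For $2\le n<\infty$, $\mathcal{O}_n$ denotes the Cuntz algebra: the universal unital C$^*$-algebra generated by $s_1,\ldots,s_n$ with $s_i^*s_j=\delta_{ij}I$ and $\sum_{i=1}^n s_is_i^*=I$. $(\mathbb{C}^m)_1$ is the set of unit vectors of $\mathbb{C}^m$, and $\ell^2_1$ the set of unit vectors of $\ell^2=\ell^2(\{1,2,\ldots\})$. Convention: $s_n^0=I$. Geometric progression states (such states always exist): - Order $k$ ($1\le k<\infty$, $m=(n-1)k+1$): a state $\omega$ on $\mathcal{O}_n$ is a geometric progression state by $z\in(\mathbb{C}^m)_1$ if $\omega(s_n^rs_i)=\overline{z_{(n-1)r+i}}$ for all $r=0,\ldots,k-1$ and $i=1,\ldots,n-1$, and $\omega(s_n^k)=\overline{z_m}$. - Order $\infty$: a state $\omega$ on $\mathcal{O}_n$ is a geometric progression state by $z\in\ell^2_1$ if $\omega(s_n^rs_i)=\overline{z_{(n-1)r+i}}$ for all $r\ge 0$ and $i=1,\ldots,n-1$. *)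

(* Defs.v *)
From HB Require Import structures.
From mathcomp Require Import all_boot all_order all_algebra.
From mathcomp Require Import all_classical all_reals all_analysis.
From mathcomp Require Export complex.
Set Implicit Arguments.
Unset Strict Implicit.
Unset Printing Implicit Defensive.
Import Order.TTheory GRing.Theory Num.Theory.
Import numFieldNormedType.Exports.
Local Open Scope classical_set_scope.
Local Open Scope ring_scope.

(* The library cannot join [algType C] with [normedModType C], so the norm and
   its completeness are part of the mixin. As for the library's norms over [C],
   the norm takes its values in [C]; homogeneity and the triangle inequality
   make it nonnegative, hence real. In the intended application [C] is [R[i]]
   for [R : realType]. *)
HB.mixin Record isCStarAlgebra (C : numClosedFieldType) A of GRing.Algebra C A
    := {
  star : A -> A ;
  starK : forall x : A, star (star x) = x ;
  starD : forall x y : A, star (x + y) = star x + star y ;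
  starZ : forall (a : C) (x : A), star (a *: x) = a^* *: star x ;
  starM : forall x y : A, star (x * y) = star y * star x ;
  cnorm : A -> C ;
  cnorm0_eq0 : forall x : A, cnorm x = 0 -> x = 0 ;
  ler_cnormD : forall x y : A, cnorm (x + y) <= cnorm x + cnorm y ;
  cnormZ : forall (a : C) (x : A), cnorm (a *: x) = `|a| * cnorm x ;
  ler_cnormM : forall x y : A, cnorm (x * y) <= cnorm x * cnorm y ;
  cnorm_star_mul : forall x : A, cnorm (star x * x) = cnorm x ^+ 2 ;
  cnorm_complete : forall u : nat -> A,
    (forall e : C, 0 < e -> exists N, forall p q, (N <= p)%N -> (N <= q)%N ->
       cnorm (u p - u q) < e) ->
    exists x, forall e : C, 0 < e -> exists N, forall p, (N <= p)%N ->
      cnorm (u p - x) < e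
}.

#[short(type="cstarAlgebraType")]
HB.structure Definition CStarAlgebra (C : numClosedFieldType) :=
  {A of isCStarAlgebra C A & GRing.Algebra C A}.

Section CuntzAlgebra.
Variables (C : numClosedFieldType) (n : nat).

Definition cuntz_relations (A : cstarAlgebraType C) (s : 'I_n -> A) : Prop :=
  (forall i j, star (s i) * s j = (i == j)%:R) /\
  \sum_i s i * star (s i) = 1.

Definition star_subalgebra (A : cstarAlgebraType C) (S : set A) : Prop :=
  [/\ S 1,
      forall (a : C) x y, S x -> S y -> S (a *: x + y),
      forall x y, S x -> S y -> S (x * y) &
      forall x, S x -> S (star x)].

Definition cnorm_closed (A : cstarAlgebraType C) (S : set A) : Prop :=
  forall x, (forall e : C, 0 < e -> exists2 y, S y & cnorm (x - y) < e) -> S x.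

Definition cstar_generates (A : cstarAlgebraType C) (s : 'I_n -> A) : Prop :=
  forall S : set A, star_subalgebra S -> cnorm_closed S -> (forall i, S (s i)) ->
    S = setT.

(* [A] with generators [s] is a model of the Cuntz algebra. The morphism [f] is
   unique because [s] generates [A] and star-morphisms are continuous. *)
Definition is_cuntz_algebra (A : cstarAlgebraType C) (s : 'I_n -> A) : Prop :=
  [/\ cuntz_relations s,
      cstar_generates s &
      forall (B : cstarAlgebraType C) (t : 'I_n -> B), cuntz_relations t ->
        exists f : {lrmorphism A -> B},
          (forall x, f (star x) = star (f x)) /\ (forall i, f (s i) = t i)].

End CuntzAlgebra.

Section States.
Variables (C : numClosedFieldType) (A : cstarAlgebraType C).

Definition is_state (w : A -> C) : Prop :=
  [/\ scalar w, forall x, 0 <= w (star x * x) & w 1 = 1].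

(* Extreme points of the convex set of states. The condition [0 < t < 1] makes
   [t : C] real. *)
Definition is_pure_state (w : A -> C) : Prop :=
  is_state w /\
  forall (t : C) (w1 w2 : A -> C), is_state w1 -> is_state w2 ->
    0 < t < 1 -> (forall x, w x = t * w1 x + (1 - t) * w2 x) ->
    w1 = w /\ w2 = w.

End States.

(* Indices are shifted by one: generators are numbered from 0 to n - 1, and the
   coordinates of vectors from 0, so that the coordinate (n-1)r+i of the usual
   numbering, 1 <= i <= n-1, becomes (n-1)r+i with 0 <= i < n-1. *)

Lemma last_index_subproof n : (1 < n)%N -> (n.-1 < n)%N.
Proof. by case: n. Qed.

Definition last_index n (hn : (1 < n)%N) : 'I_n :=
  Ordinal (last_index_subproof hn).

Definition unit_vector (C : numClosedFieldType) m (z : 'rV[C]_m) : Prop :=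
  \sum_i `|z 0 i| ^+ 2 = 1.

Definition unit_l2 (C : numClosedFieldType) (z : nat -> C) : Prop :=
  series (fun i => `|z i| ^+ 2) @ \oo --> (1 : C).

Section GeometricProgressionStates.
Variables (C : numClosedFieldType) (A : cstarAlgebraType C).
Variables (n : nat) (hn : (1 < n)%N) (s : 'I_n -> A).

Let sn : A := s (last_index hn).
Let s' (i : 'I_n.-1) : A := s (widen_ord (leq_pred n) i).

Definition gp_state k (z : 'rV[C]_(n.-1 * k).+1) (w : A -> C) : Prop :=
  [/\ is_state w,
      forall (r : 'I_k) (i : 'I_n.-1),
        w (sn ^+ r * s' i) = (z 0 (inord (n.-1 * r + i)))^* &
      w (sn ^+ k) = (z 0 ord_max)^*].

Definition gp_state_infinite (z : nat -> C) (w : A -> C) : Prop :=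
  is_state w /\
  forall (r : nat) (i : 'I_n.-1), w (sn ^+ r * s' i) = (z (n.-1 * r + i)%N)^*.

End GeometricProgressionStates.

(* Main.v *)
Require Import Defs.
From mathcomp Require Import all_boot all_order all_algebra.
From mathcomp Require Import all_classical all_reals all_analysis.
From mathcomp Require Import ring.
Set Implicit Arguments.
Unset Strict Implicit.
Unset Printing Implicit Defensive.
Import Order.TTheory GRing.Theory Num.Theory.
Local Open Scope ring_scope.

(** Write [t_j] for the isometries [s_n^r s_i] (and [s_n^k] in finite order) and
    [x'] for the adjoint; the [t_j] have orthogonal ranges. For a state [w] and
    a unit vector [z], having [w t_j = conj z_j] for all [j] is equivalent to
    vanishing on every [(t_j' - z_j)' (t_j' - z_j)], which in turn gives
    [w (t_j x) = conj z_j * w x] for all [x].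

    Uniqueness: the difference [d] of two such states is zero on the span of the
    [s_I s_J'], which is dense. The eigenvalue relations reduce [s_I s_J'] to
    [s_n^r s_n'^q], and inserting [1 = sum_j t_j t_j' + s_n^L s_n'^L] in the
    middle shifts both exponents by [L]. In finite order this yields
    [d (s_n^e) = |z_m|^2 d (s_n^e)]; in infinite order the shifted values tend
    to zero. Purity follows: if a convex combination of states vanishes on a
    positive element, so does each of them. If [|z_m| = 1], each [k]-th root [a]
    of [conj z_m] gives a solution with [w s_n = a].

    Existence: [x' x + y' y = u' u] for [u = s_1 x + s_2 y], so the elements
    [x' x] form a proper convex cone with order unit, and Zorn's lemma extends
    cones to total ones, that is, to states. For [v = sum_j z_j t_j], a
    non-unitary isometry, the elements [sum_(k < N) v^k (1 - v v')] are almost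
    fixed by [v], which makes [- (1 - v)' (1 - v)] compatible with the cone;
    infinite order is a limit of finite ones. *)

(** * C*-algebras and their states *)

Section CStarAlgebraTheory.
Variables (C : numClosedFieldType) (A : cstarAlgebraType C).
Implicit Types x y : A.

Lemma star0 : star (0 : A) = 0.
Proof. by rewrite -(scale0r (0 : A)) starZ conjC0 !scale0r. Qed.

Lemma starN x : star (- x) = - star x.
Proof. by rewrite -scaleN1r starZ rmorphN1 scaleN1r. Qed.

Lemma starB x y : star (x - y) = star x - star y.
Proof. by rewrite starD starN. Qed.

Lemma star1 : star (1 : A) = 1.
Proof. by rewrite -[LHS]mulr1 -{2}[1]starK -starM mulr1 starK. Qed.

Lemma star_sum (J : Type) (r : seq J) (P : pred J) (F : J -> A) :
  star (\sum_(j <- r | P j) F j) = \sum_(j <- r | P j) star (F j).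
Proof. exact: (big_morph _ (@starD _ A) star0). Qed.

Lemma cnorm0 : cnorm (0 : A) = 0.
Proof. by rewrite -(scale0r (0 : A)) cnormZ normr0 mul0r. Qed.

Lemma cnormN x : cnorm (- x) = cnorm x.
Proof. by rewrite -scaleN1r cnormZ normrN1 mul1r. Qed.

Lemma cnormB x y : cnorm (x - y) = cnorm (y - x).
Proof. by rewrite -cnormN opprB. Qed.

Lemma cnorm_ge0 x : 0 <= cnorm x.
Proof.
have := ler_cnormD x (- x); rewrite subrr cnorm0 cnormN -mulr2n.
by rewrite pmulrn_lge0.
Qed.

(** Since [cnorm x ^+ 2 = cnorm (x' x) <= cnorm x' * cnorm x], a factor [cnorm x] cancels; applying
    this to [x'] as well gives equality. *)
Lemma ler_cnorm_star x : cnorm x <= cnorm (star x).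
Proof.
have [->|x0] := eqVneq (cnorm x) 0; first exact: cnorm_ge0.
rewrite -(ler_pM2r (x := cnorm x)) ?lt_neqAle ?cnorm_ge0 1?eq_sym ?x0 //.
by rewrite -expr2 -cnorm_star_mul ler_cnormM.
Qed.

Lemma cnorm_star x : cnorm (star x) = cnorm x.
Proof.
by apply/le_anti; rewrite ler_cnorm_star andbT -{2}(starK x) ler_cnorm_star.
Qed.

Lemma star_mul_eq0 x : star x * x = 0 -> x = 0.
Proof.
move=> h; apply: cnorm0_eq0; apply/eqP.
by rewrite -sqrf_eq0 -cnorm_star_mul h cnorm0.
Qed.

Lemma cnorm_small_eq0 x : (forall e : C, 0 < e -> cnorm x < e) -> x = 0.
Proof.
move=> h; apply: cnorm0_eq0; apply/eqP; apply/negPn/negP => x0.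
have /h : 0 < cnorm x by rewrite lt_neqAle cnorm_ge0 eq_sym x0.
by rewrite ltxx.
Qed.

Lemma ler_cnorm_trans x y z : cnorm (x - z) <= cnorm (x - y) + cnorm (y - z).
Proof. by rewrite -{1}(subrK y x) -addrA ler_cnormD. Qed.

End CStarAlgebraTheory.

(** * Square roots of elements close to the unit *)

Section SquareRoot.
Variables (R : realType) (A : cstarAlgebraType R[i]).
Implicit Types a b x y : A.

Lemma complex_archi (e : R[i]) : e \is Num.real -> exists N : nat, e < N%:R.
Proof.
case: e => a b; rewrite complex_real => /= /eqP ->.
exists (Num.Def.archi_bound `|a|); set N := Num.Def.archi_bound _.
rewrite -(rmorph_nat (real_complex R)) ltcR.
by apply: le_lt_trans (ler_norm a) (archi_boundP _); rewrite normr_ge0.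
Qed.

Let half : R[i] := 2^-1.

Definition sqrt_iter a := fun m => iter m (fun b => half *: (a + b * b)) 0.

Lemma half_real : 0 < half. Proof. by rewrite invr_gt0 ltr0n. Qed.

(** The splitting [b^2 - c^2 = b (b - c) + (b - c) c] holds without commutativity, and the outer
    factors have norm at most [1/2]. *)
Lemma sqrt_step_contract a b c : cnorm b <= half -> cnorm c <= half ->
  cnorm (half *: (a + b * b) - half *: (a + c * c)) <= half * cnorm (b - c).
Proof.
move=> hb hc; rewrite -scalerBr cnormZ gtr0_norm ?half_real //.
rewrite ler_pM2l ?half_real // opprD addrACA subrr add0r.
have -> : b * b - c * c = b * (b - c) + (b - c) * c.
  by rewrite mulrBr mulrBl addrA subrK.
apply: le_trans (ler_cnormD _ _) _.
have -> : cnorm (b - c) = half * cnorm (b - c) + cnorm (b - c) * half.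
  by rewrite [RHS]addrC mulrC -mulrDl -[half]mul1r -splitr mul1r.
apply: lerD; apply: le_trans (ler_cnormM _ _) _.
  by rewrite ler_wpM2r ?cnorm_ge0.
by rewrite ler_wpM2l ?cnorm_ge0.
Qed.

Lemma sqrt_step_bound a b : cnorm a <= half -> cnorm b <= half ->
  cnorm (half *: (a + b * b)) <= half.
Proof.
move=> ha hb; rewrite cnormZ gtr0_norm ?half_real //.
rewrite -[leRHS]mulr1 ler_pM2l ?half_real //.
apply: le_trans (ler_cnormD _ _) _; rewrite [leRHS]splitr mul1r.
apply: lerD => //; apply: le_trans (ler_cnormM _ _) _.
rewrite -[leRHS]mulr1; apply: ler_pM; rewrite ?cnorm_ge0 //.
by apply: le_trans hb _; rewrite invf_le1 ?ler1n ?ltr0n.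
Qed.

Lemma sqrt_iter_bound a m : cnorm a <= half -> cnorm (sqrt_iter a m) <= half.
Proof.
move=> ha; elim: m => [|m IH] /=; first by rewrite cnorm0 ltW ?half_real.
exact: sqrt_step_bound.
Qed.

(** Each of the [m] common steps contracts by [1/2], starting from the distance between [d] steps
    and none. *)
Lemma sqrt_iter_cauchy a m d : cnorm a <= half ->
  cnorm (sqrt_iter a (m + d) - sqrt_iter a m) <= half ^+ m.
Proof.
move=> ha; elim: m => [|m IH].
  rewrite add0n subr0 expr0; apply: le_trans (sqrt_iter_bound _ ha) _.
  by rewrite invf_le1 ?ler1n ?ltr0n.
rewrite addSn exprS; apply: le_trans (sqrt_step_contract _ _ _) _.
- exact: sqrt_iter_bound.
- exact: sqrt_iter_bound.
- by rewrite ler_pM2l ?half_real.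
Qed.

Lemma sqrt_iter_star a m : star a = a -> star (sqrt_iter a m) = sqrt_iter a m.
Proof.
move=> ha; elim: m => [|m IH] /=; first by rewrite star0.
by rewrite starZ starD starM IH ha fmorphV rmorph_nat.
Qed.

Lemma half_expn_small (e : R[i]) : 0 < e -> exists N, forall m, (N <= m)%N ->
  half ^+ m < e.
Proof.
move=> e0; have [|N hN] := @complex_archi e^-1;
  first by rewrite realV gtr0_real.
exists N => m hm.
rewrite exprVn -[ltRHS]invrK ltf_pV2 ?posrE ?invr_gt0 ?exprn_gt0 ?ltr0n //.
apply: lt_trans hN _; rewrite -natrX ltr_nat.
by apply: leq_ltn_trans hm _; exact: ltn_expl.
Qed.

(* The square root [1 - b] of [1 - a] is given by the fixed point [b] of the
   contraction [b |-> (a + b^2) / 2]. *)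
Lemma star_sqrt a : star a = a -> cnorm a <= half ->
  exists y, star y * y = 1 - a.
Proof.
move=> sa ha.
have [e e0|b hb] := @cnorm_complete _ A (sqrt_iter a).
  have e2 : 0 < e / 2 by rewrite divr_gt0 ?ltr0n.
  have [N hN] := half_expn_small e2; exists N.
  have near q : (N <= q)%N -> cnorm (sqrt_iter a q - sqrt_iter a N) < e / 2.
    move=> hq; rewrite -(subnKC hq).
    by apply: le_lt_trans (sqrt_iter_cauchy _ _ ha) _; exact: hN.
  move=> p q hp hq; apply: le_lt_trans (ler_cnorm_trans _ (sqrt_iter a N) _) _.
  by rewrite [ltRHS]splitr ltrD ?near // cnormB near.
have bb : cnorm b <= half.
  rewrite real_leNgt ?ger0_real ?cnorm_ge0 ?(ltW half_real) //.
  apply/negP; rewrite -subr_gt0 => /hb [N /(_ _ (leqnn _))].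
  apply/negP; rewrite -real_leNgt ?realB ?ger0_real ?cnorm_ge0 //; last first.
    exact: ltW half_real.
  rewrite lerBlDr; apply: le_trans (_ :
    cnorm (b - sqrt_iter a N) + cnorm (sqrt_iter a N) <= _).
    by rewrite -{1}(subrK (sqrt_iter a N) b) ler_cnormD.
  by rewrite cnormB lerD2l sqrt_iter_bound.
have sb : star b = b.
  apply/eqP; rewrite -subr_eq0; apply/eqP/cnorm_small_eq0 => e e0.
  have e2 : 0 < e / 2 by rewrite divr_gt0 ?ltr0n.
  have [N /(_ _ (leqnn _)) hN] := hb _ e2.
  apply: le_lt_trans (ler_cnorm_trans _ (sqrt_iter a N) _) _.
  rewrite [ltRHS]splitr ltrD //.
  by rewrite -{1}(sqrt_iter_star N sa) -starB cnorm_star cnormB.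
(* Both sides are limits of the iterates, the right one by contraction. *)
have fb : b = half *: (a + b * b).
  apply/eqP; rewrite -subr_eq0; apply/eqP/cnorm_small_eq0 => e e0.
  have e2 : 0 < e / 2 by rewrite divr_gt0 ?ltr0n.
  have [N hN] := hb _ e2.
  apply: le_lt_trans (ler_cnorm_trans _ (sqrt_iter a N.+1) _) _.
  rewrite [ltRHS]splitr ltrD ?[cnorm (b - _)]cnormB ?hN //.
  apply: le_lt_trans (sqrt_step_contract _ _ bb) _;
    first exact: sqrt_iter_bound.
  apply: le_lt_trans (hN _ (leqnn _)).
  rewrite -[leRHS]mul1r ler_wpM2r ?cnorm_ge0 //.
  by rewrite invf_le1 ?ler1n ?ltr0n.
exists (1 - b); rewrite starB star1 sb mulrBl mul1r mulrBr mulr1.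
(* The fixed point equation reads [2 b = a + b^2], whence [(1 - b)^2 = 1 - a]. *)
have -> : a = b + b - b * b.
  rewrite -[X in _ = X - _](_ : a + b * b = _) ?addrK //.
  rewrite -mulr2n {3}fb -scaler_nat scalerA mulfV ?pnatr_eq0 ?scale1r //.
by rewrite !opprB opprD -addrA; congr (_ + _); rewrite addrCA.
Qed.

End SquareRoot.

(** * Positive functionals, Cauchy-Schwarz and boundedness *)

Section LinearForms.
Variables (C : numClosedFieldType) (A : cstarAlgebraType C) (w : A -> C).
Hypothesis lw : scalar w.
Implicit Types x y : A.

Lemma formD x y : w (x + y) = w x + w y.
Proof. by rewrite -{1}[x]scale1r lw mul1r. Qed.

Lemma form0 : w 0 = 0.
Proof. by apply: (addrI (w 0)); rewrite -formD !addr0. Qed.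

Lemma formZ a x : w (a *: x) = a * w x.
Proof. by rewrite -{1}[a *: x]addr0 lw form0 addr0. Qed.

Lemma formN x : w (- x) = - w x.
Proof. by rewrite -scaleN1r formZ mulN1r. Qed.

Lemma formB x y : w (x - y) = w x - w y.
Proof. by rewrite formD formN. Qed.

Lemma form_sum (J : Type) (r : seq J) (P : pred J) (F : J -> A) :
  w (\sum_(j <- r | P j) F j) = \sum_(j <- r | P j) w (F j).
Proof. exact: (big_morph _ formD form0). Qed.

Lemma form_sesquilinear x y c :
  w (star (x + c *: y) * (x + c *: y)) =
  w (star x * x) + c * w (star x * y) + c^* * w (star y * x)
    + `|c| ^+ 2 * w (star y * y).
Proof.
rewrite starD starZ mulrDl !mulrDr !formD -!scalerAl -!scalerAr.
by rewrite !formZ normCK mulrA [c^* * c]mulrC !addrA.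
Qed.

End LinearForms.

Section StateTheory.
Variables (C : numClosedFieldType) (A : cstarAlgebraType C) (w : A -> C).
Hypothesis hw : is_state w.
Implicit Types x y : A.

Lemma state_scalar : scalar w. Proof. by case: hw. Qed.
Lemma state_ge0 x : 0 <= w (star x * x). Proof. by case: hw. Qed.
Lemma state1 : w 1 = 1. Proof. by case: hw. Qed.

(** The value at [(x + c)' (x + c)] is real for every scalar [c]; comparing [c = 1] with [c = 'i]
    determines [w x']. *)
Lemma state_star x : w (star x) = (w x)^*.
Proof.
have key c : (c * w (star x) + c^* * w x)^* = c * w (star x) + c^* * w x.
  have := state_ge0 (x + c *: 1).
  rewrite (form_sesquilinear state_scalar) star1 mulr1 mul1r mul1r state1 mulr1.
  move=> /ger0_real hr; apply/CrealP.
  suff -> : c * w (star x) + c^* * w x =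
    (w (star x * x) + c * w (star x) + c^* * w x +
    `|c| ^+ 2) - w (star x * x) - `|c| ^+ 2 by
    rewrite ?rpredB // ?rpredX ?normr_real // ger0_real // state_ge0.
  by ring.
have := key 1; have := key 'i.
rewrite !rmorphD !rmorphM /= !conjCK conjCi rmorph1 !mul1r => h1 h2.
have {}h1 : (w x)^* - (w (star x))^* = w (star x) - w x.
  by apply: (mulfI (neq0Ci C)); rewrite !mulrBr -!mulNr addrC h1.
apply: (mulIf (x := 2)); first by rewrite pnatr_eq0.
have -> : (w x)^* * 2 = ((w x)^* - (w (star x))^*) + ((w (star x))^* + (w x)^*).
  by ring.
by rewrite h1 h2; ring.
Qed.

Lemma state_cauchy_schwarz x y :
  `|w (star y * x)| ^+ 2 <= w (star x * x) * w (star y * y).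
Proof.
have E : w (star x * y) = (w (star y * x))^*.
  by rewrite -state_star starM starK.
have key c : 0 <= w (star x * x) + c * (w (star y * x))^* + c^* * w (star y * x)
    + `|c| ^+ 2 * w (star y * y).
  by rewrite -E -(form_sesquilinear state_scalar) state_ge0.
have a0 := state_ge0 x; have := state_ge0 y; move: key a0.
set a := w (star x * x); set b := w (star y * y); set p := w (star y * x).
move=> key a0; rewrite le_eqVlt => /orP[/eqP b0|b0].
  rewrite -b0 mulr0; have [->|p0] := eqVneq p 0; first by rewrite normr0 expr0n.
  have P0 : 0 < `|p| ^+ 2 by rewrite exprn_gt0 // normr_gt0.
  (* When [w (y' y) = 0], this [t] makes the form at [c = - t p] equal to [-1]. *)
  pose t := (a + 1) / (2 * `|p| ^+ 2).
  have t0 : t^* = t.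
    by apply/CrealP; rewrite ger0_real // divr_ge0 ?addr_ge0 // mulr_ge0 // ltW.
  have := key (- (t * p)); rewrite -b0 mulr0 addr0 rmorphN rmorphM /= t0.
  have -> : a + - (t * p) * p^* + - (t * p^*) * p = a - t * (2 * `|p| ^+ 2).
    by rewrite normCK; ring.
  rewrite divfK; last by rewrite mulf_neq0 ?pnatr_eq0 ?gt_eqF.
  by rewrite opprD addrA subrr sub0r oppr_ge0 ler10.
have bc : b^* = b by apply/CrealP; rewrite gtr0_real.
have bn : b != 0 by rewrite gt_eqF.
(* The quadratic form in [c] is minimal here. *)
have := key (- (p / b)); rewrite rmorphN rmorphM fmorphV /= bc.
rewrite normrN normrM normfV [`|b|]gtr0_norm // -(ler_pM2r b0) mul0r.
suff -> : (a + - (p / b) * p^* + - (p^* / b) * p + (`|p| / b) ^+ 2 * b) * b =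
  a * b - `|p| ^+ 2 by rewrite subr_ge0.
by rewrite expr_div_n normCK; field.
Qed.

Lemma state_null x y : w (star x * x) = 0 -> w (y * x) = 0.
Proof.
move=> x0; have := state_cauchy_schwarz x (star y).
rewrite x0 mul0r starK => h; apply/eqP; rewrite -normr_eq0 -sqrf_eq0.
by rewrite eq_le h exprn_ge0.
Qed.

Lemma state_norm_sqr_le x : `|w x| ^+ 2 <= w (star x * x).
Proof.
by have := state_cauchy_schwarz x 1; rewrite star1 !mul1r state1 mulr1.
Qed.

End StateTheory.

Section StateBound.
Variables (R : realType) (A : cstarAlgebraType R[i]) (w : A -> R[i]).
Hypothesis hw : is_state w.

(** Scaled by [1 / (2 cnorm x ^+ 2)], [x' x] has norm [1/2], so the unit minus it is some [y' y];
    positivity then bounds [w (x' x)], hence [w x]. The constant [2] is crude, but continuity is all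
    that is wanted. *)
Lemma state_bound x : `|w x| <= 2 * cnorm x.
Proof.
have [->|x0] := eqVneq x 0.
  by rewrite (form0 (state_scalar hw)) normr0 mulr_ge0 ?cnorm_ge0.
have c0 : 0 < cnorm x.
  rewrite lt_neqAle cnorm_ge0 eq_sym andbT.
  by apply: contra_neq x0 => /cnorm0_eq0.
have c20 : 0 < 2 * cnorm x ^+ 2 by rewrite mulr_gt0 ?exprn_gt0.
have n0 : 0 < (2 * cnorm x ^+ 2)^-1 by rewrite invr_gt0.
have nr : ((2 * cnorm x ^+ 2)^-1)^* = (2 * cnorm x ^+ 2)^-1 :> R[i].
  by apply/CrealP; rewrite gtr0_real.
have [||y hy] := @star_sqrt _ _ ((2 * cnorm x ^+ 2)^-1 *: (star x * x)).
- by rewrite starZ starM starK nr.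
- rewrite cnormZ cnorm_star_mul gtr0_norm // invfM mulfVK //.
  by rewrite sqrf_eq0 gt_eqF.
have := state_ge0 hw y.
rewrite hy (formB (state_scalar hw)) (formZ (state_scalar hw)) state1 //.
rewrite subr_ge0 ler_pdivrMl // mulr1 => h.
rewrite -(ler_pXn2r (n := 2)) ?nnegrE ?mulr_ge0 ?cnorm_ge0 //.
apply: le_trans (state_norm_sqr_le hw x) _; apply: le_trans h _.
by rewrite exprMn ler_pM2r ?exprn_gt0 // -natrX ler_nat.
Qed.

End StateBound.

(** * States from convex cones *)

Section Cone.
Variables (R : realType) (A : cstarAlgebraType R[i]).
Implicit Types (K N : set A) (x y h : A).

Definition convex_cone N : Prop :=
  (forall x y, N x -> N y -> N (x + y)) /\
  (forall (a : R[i]) x, 0 <= a -> N x -> N (a *: x)).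

(** Totality makes [K] decide every comparison with a real scalar, so that a state can be read off
    as a Dedekind cut. *)
Definition total_positive_cone K : Prop :=
  [/\ convex_cone K, forall x, K (star x * x), ~ K (- 1) &
      forall x, K x \/ K (- x)].

Lemma total_cone_extension K0 : convex_cone K0 ->
  (forall x, K0 (star x * x)) -> ~ K0 (- 1) ->
  exists2 K, total_positive_cone K & (K0 `<=` K)%classic.
Proof.
move=> cK0 pK0 nK0.
(* The last clause, rather than [K0 `<=` K], makes the empty set admissible, as
   Zorn's lemma requires of the union of the empty chain. *)
pose P K := [/\ convex_cone K, ~ K (- 1) & forall x y, K x -> K0 y ->
  K (x + y)].
have [F FP Ftot|K [[cK nK KK0] maxK]] := @Zorn_bigcup A P.
  split; first split.
  - move=> x y [X FX Xx] [Y FY Yy].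
    have [XY|YX] := Ftot _ _ FX FY.
      exists Y => //; have [[cY _] _ _] := FP _ FY; apply: cY => //; exact: XY.
    exists X => //; have [[cX _] _ _] := FP _ FX; apply: cX => //; exact: YX.
  - move=> a x a0 [X FX Xx]; exists X => //.
    by have [[_ cX] _ _] := FP _ FX; exact: cX.
  - by move=> [X FX]; have [] := FP _ FX.
  - move=> x y [X FX Xx] Ky; exists X => //.
    by have [_ _] := FP _ FX; apply.
(* An empty [K] would not be maximal, since [K0] is admissible and nonempty. *)
have K1 : exists x, K x.
  apply: contrapT => /forallNP K0'; apply: (maxK K0).
    split; first by move=> x /K0'.
    by move/(_ _ (pK0 0)) => /K0'.
  by split => // x y; case: cK0 => + _; exact.
have K00 : K 0 by case: K1 => x /(cK.2 0); rewrite scale0r; exact.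
have sK : (K0 `<=` K)%classic by move=> x /(KK0 _ _ K00); rewrite add0r.
exists K => //; split => // [x|x]; first exact/sK/pK0.
apply: contrapT => /not_orP[nx nNx].
(* If neither [x] nor [- x] lies in [K], adjoining the ray of [x] contradicts maximality: from
   [- 1 = k + a x] with [0 < a] one gets [- x = (1 + k) / a] in [K]. *)
pose K' := [set y | exists k a, [/\ K k, 0 <= a & y = k + a *: x]]%classic.
apply: (maxK K').
  split.
    by move=> y Ky; exists y, 0; rewrite lexx scale0r addr0.
  move=> /(_ x) h; apply/nx/h.
  by exists 0, 1; rewrite ler01 scale1r add0r.
split.
- split.
    move=> _ _ [k [a [Kk a0 ->]]] [l [b [Kl b0 ->]]].
    exists (k + l), (a + b); rewrite addr_ge0 // scalerDl addrACA; split => //.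
    exact: cK.1.
  move=> c _ c0 [k [a [Kk a0 ->]]].
  exists (c *: k), (c * a); rewrite mulr_ge0 // scalerDr scalerA; split => //.
  exact: cK.2.
- move=> [k [a [Kk a0 e]]]; move: a0; rewrite le_eqVlt => /orP[/eqP a0|a0].
    by apply: nK; rewrite e -a0 scale0r addr0.
  apply: nNx.
  have -> : - x = a^-1 *: (1 + k).
    rewrite (_ : k = - 1 - a *: x); last by rewrite e addrK.
    by rewrite addrA subrr add0r scalerN scalerA mulVf ?gt_eqF // scale1r.
  apply: cK.2; first by rewrite invr_ge0 ltW.
  apply: cK.1 => //; have := pK0 1; rewrite star1 mulr1; exact: sK.
- move=> _ y [k [a [Kk a0 ->]]] Ky; exists (k + y), a; split => //.
    exact: KK0.
  by rewrite addrAC.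
Qed.

End Cone.

(** * The state defined by a total cone *)

Section ConeFunctional.
Variables (R : realType) (A : cstarAlgebraType R[i]) (K : set A).
Hypothesis hK : total_positive_cone K.
Implicit Types (x y : A) (t : R).

Local Notation sc t := ((t%:C)%C *: (1 : A)).

Let KD x y : K x -> K y -> K (x + y). Proof. by case: hK => -[+ _] _ _ _;
  exact. Qed.
Let KZ (a : R[i]) x : 0 <= a -> K x -> K (a *: x).
Proof. by case: hK => -[_ +] _ _ _; exact. Qed.
Let Ksq x : K (star x * x). Proof. by case: hK. Qed.

Let scD t u : sc (t + u) = sc t + sc u. Proof. by rewrite rmorphD scalerDl. Qed.
Let scN t : sc (- t) = - sc t. Proof. by rewrite rmorphN scaleNr. Qed.

Lemma cone_scalar t : K (sc t) <-> 0 <= t.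
Proof.
have K1 : K 1 by rewrite -[1]mulr1 -{1}star1; exact: Ksq.
split=> [Kt|t0]; last by apply: KZ => //; rewrite ler0c.
rewrite leNgt; apply/negP => t0; case: hK => _ _ + _; apply.
have -> : - 1 = ((- t)^-1%:C)%C *: sc t.
  rewrite scalerA -rmorphM invrN mulNr mulVf ?lt_eqF //.
  by rewrite rmorphN rmorph1 scaleN1r.
by apply: KZ => //; rewrite ler0c invr_ge0 oppr_ge0 ltW.
Qed.

Let K_le t u x : K (x - sc t) -> K (sc u - x) -> t <= u.
Proof.
move=> h1 h2; have := KD h2 h1.
by rewrite addrA subrK -scN -scD => /cone_scalar; rewrite subr_ge0.
Qed.

(** With [t = 2 (cnorm x + 1)] the element [x / t] has norm at most [1/2], so [1 - x / t] is of the
    form [y' y]. The added [1] keeps [t] nonzero. *)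
Lemma cone_order_unit x : star x = x -> exists t, K (sc t - x).
Proof.
move=> sx; pose n := 2 * (cnorm x + 1).
have p0 : 0 < cnorm x + 1 by rewrite ltr_wpDl ?cnorm_ge0.
have n0 : 0 < n by rewrite mulr_gt0.
have nc : n^-1 \is Num.real by rewrite gtr0_real ?invr_gt0.
have [||y hy] := @star_sqrt _ _ (n^-1 *: x).
- by rewrite starZ sx (CrealP nc).
- rewrite cnormZ gtr0_norm ?invr_gt0 // invfM -mulrA ler_piMr ?invr_ge0 //.
  by rewrite mulrC ler_pdivrMr // mul1r lerDl.
exists (complex.Re n); rewrite RRe_real ?gtr0_real //.
have -> : n *: 1 - x = n *: (star y * y).
  by rewrite hy scalerBr scalerA mulfV ?gt_eqF // scale1r.
by apply: KZ; rewrite // ltW.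
Qed.

Let f x : R := sup [set t : R | K (x - sc t)]%classic.

Let f_has_sup x : star x = x -> has_sup [set t : R | K (x - sc t)]%classic.
Proof.
move=> sx; split.
  have [|t ht] := @cone_order_unit (- x); first by rewrite starN sx.
  by exists (- t) => /=; rewrite scN opprK addrC; rewrite opprK in ht.
have [t ht] := cone_order_unit sx.
by exists t => u /= hu; exact: K_le hu ht.
Qed.

Let f_ge t x : star x = x -> K (x - sc t) -> t <= f x.
Proof. by move=> /f_has_sup [_ h] Kt; apply: ub_le_sup. Qed.

Let f_le t x : star x = x -> K (sc t - x) -> f x <= t.
Proof.
move=> /f_has_sup [h _] Kt; apply: ge_sup => // u /= hu; exact: K_le hu Kt.
Qed.

(** [K] need not be closed, hence the margin [e]. By totality, failure would put the opposite
    element in [K] and force [f x <= f x - e]. *)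
Let f_lb x e : star x = x -> 0 < e -> K (x - sc (f x - e)).
Proof.
move=> sx e0; case: hK => _ _ _ /(_ (x - sc (f x - e))) [//|].
rewrite opprB => /(f_le sx); rewrite leNgt => /negP; case.
by rewrite gtrBl.
Qed.

Let f_ub x e : star x = x -> 0 < e -> K (sc (f x + e) - x).
Proof.
move=> sx e0; case: hK => _ _ _ /(_ (sc (f x + e) - x)) [//|].
rewrite opprB => /(f_ge sx); rewrite leNgt => /negP; case.
by rewrite ltrDl.
Qed.

Let f_uniq x a : star x = x ->
  (forall e, 0 < e -> K (x - sc (a - e)) /\ K (sc (a + e) - x)) -> f x = a.
Proof.
move=> sx h; apply/le_anti/andP; split; apply/ler_addgt0Pr => e /h [h1 h2].
  exact: f_le.
by rewrite -lerBlDr; exact: f_ge.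
Qed.

Let fD x y : star x = x -> star y = y -> f (x + y) = f x + f y.
Proof.
move=> sx sy; apply: f_uniq => [|e e0]; first by rewrite starD sx sy.
have e2 : 0 < e / 2 by rewrite divr_gt0.
split.
  have := KD (f_lb sx e2) (f_lb sy e2).
  by rewrite addrACA -opprD -scD addrACA -opprD -splitr.
have := KD (f_ub sx e2) (f_ub sy e2).
by rewrite addrACA -opprD -scD addrACA -splitr.
Qed.

Let fN x : star x = x -> f (- x) = - f x.
Proof.
move=> sx; apply: f_uniq => [|e e0]; first by rewrite starN sx.
split.
  have -> : - f x - e = - (f x + e) by rewrite opprD.
  by rewrite scN opprK addrC; exact: f_ub.
have -> : - f x + e = - (f x - e) by rewrite opprB addrC.
by rewrite scN opprK addrC; exact: f_lb.
Qed.

Let fpZ t x : star x = x -> 0 < t -> f ((t%:C)%C *: x) = t * f x.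
Proof.
move=> sx t0; have tc : (t%:C)%C^* = (t%:C)%C by apply/CrealP;
  rewrite complex_real.
apply: f_uniq => [|e e0]; first by rewrite starZ sx tc.
have e2 : 0 < e / t by rewrite divr_gt0.
have scZ u : sc (t * u) = (t%:C)%C *: sc u by rewrite rmorphM scalerA.
have -> : e = t * (e / t) by rewrite mulrC divfK // gt_eqF.
rewrite -mulrBr -mulrDr !scZ -!scalerBr.
by split; apply: KZ; rewrite ?ler0c ?ltW //; [exact: f_lb|exact: f_ub].
Qed.

Let f0 : f 0 = 0.
Proof. by apply: (addrI (f 0)); rewrite -fD ?star0 // !addr0. Qed.

Let fZ t x : star x = x -> f ((t%:C)%C *: x) = t * f x.
Proof.
move=> sx; have [t0|t0|<-] := ltgtP 0 t; first exact: fpZ.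
  have tc : (t%:C)%C^* = (t%:C)%C by apply/CrealP; rewrite complex_real.
  have -> : (t%:C)%C *: x = - ((- t)%:C%C *:
    x) by rewrite rmorphN scaleNr opprK.
  rewrite fN ?fpZ ?oppr_gt0 ?mulNr ?opprK //.
  by rewrite starZ sx rmorphN rmorphN /= tc.
by rewrite rmorph0 scale0r f0 mul0r.
Qed.

Let re x := (2^-1 : R[i]) *: (x + star x).
Let g x : R[i] := (f (re x))%:C%C.

Let star_re x : star (re x) = re x.
Proof. by rewrite starZ starD starK addrC fmorphV rmorph_nat. Qed.

Let gD x y : g (x + y) = g x + g y.
Proof.
rewrite -rmorphD -fD ?star_re //; congr ((f _)%:C%C).
by rewrite /re -scalerDr starD addrACA.
Qed.

Let gZ (a : R[i]) x : a \is Num.real -> g (a *: x) = a * g x.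
Proof.
move=> ra; rewrite -(RRe_real ra) -rmorphM -fZ ?star_re //; congr ((f _)%:C%C).
by rewrite (RRe_real ra) /re starZ (CrealP ra) -scalerDr !scalerA mulrC.
Qed.

(** The complex-linear form with real part [g]: the imaginary part of an element is the real part of
    its product with [- 'i]. *)
Let w x : R[i] := g x + 'i * g (- 'i *: x).

Let wD x y : w (x + y) = w x + w y.
Proof. by rewrite /w scalerDr !gD mulrDr addrACA. Qed.

Let wZr (a : R[i]) x : a \is Num.real -> w (a *: x) = a * w x.
Proof.
move=> ra; have e : - 'i *: (a *: x) = a *: (- 'i *: x).
  by rewrite !scalerA mulrC.
by rewrite /w e !(gZ _ ra) mulrDr [in RHS]mulrCA.
Qed.

Let wi x : w ('i *: x) = 'i * w x.
Proof.
have e : g ('i *: x) = - g (- 'i *: x).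
  by rewrite -mulN1r -gZ ?rpredN1 ?realN ?real1 // scaleN1r scaleNr opprK.
rewrite /w scalerA mulNr -expr2 sqrCi opprK scale1r e mulrDr mulrA -expr2.
by rewrite sqrCi mulN1r addrC.
Qed.

Let w_selfadjoint x : star x = x -> w x = (f x)%:C%C.
Proof.
move=> sx; rewrite /w /g /re starZ sx rmorphN /= conjCi opprK.
rewrite -scalerDl addNr scale0r scaler0 f0 mulr0 addr0.
by rewrite -mulr2n -(@scaler_nat R[i] A 2) scalerA mulVf ?scale1r // pnatr_eq0.
Qed.

Lemma cone_functional : exists2 w : A -> R[i], is_state w &
  forall x, star x = x -> K x -> 0 <= w x.
Proof.
have pos x : star x = x -> K x -> 0 <= w x.
  move=> sx Kx; rewrite w_selfadjoint // ler0c; apply: f_ge => //.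
  by rewrite rmorph0 scale0r subr0.
exists w => //; split.
- move=> a x y; rewrite wD; congr (_ + _).
  rewrite {1}[a]Crect scalerDl wD -scalerA wi !wZr ?Creal_Re ?Creal_Im //.
  by rewrite mulrA -mulrDl -Crect.
- by move=> x; apply: pos; rewrite ?starM ?starK //; exact: Ksq.
- rewrite w_selfadjoint ?star1 //; apply/eqP.
  rewrite (_ : f 1 = 1) ?rmorph1 //; apply: f_uniq; rewrite ?star1 // => e e0.
  have s1 : sc 1 = 1 by rewrite rmorph1 scale1r.
  have -> : 1 - sc (1 - e) = sc e.
    by rewrite -[X in X - _]s1 -scN -scD opprB addrC subrK.
  have -> : sc (1 + e) - 1 = sc e.
    by rewrite -[X in _ - X]s1 -scN -scD addrAC subrr add0r.
  by split; apply/cone_scalar; exact: ltW.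
Qed.

End ConeFunctional.

(** * Isometries with orthogonal ranges *)

Section IsometricFrames.
Variables (R : realType) (A : cstarAlgebraType R[i]).
Implicit Types (N : set A) (x y h : A).

Definition orthonormal_family (J : finType) (t : J -> A) : Prop :=
  forall i j, star (t i) * t j = (i == j)%:R.

Variables (I0 : finType) (s0 : I0 -> A) (i0 i1 : I0).
Hypotheses (os0 : orthonormal_family s0) (i01 : i0 != i1).

(* A pair of isometries with orthogonal ranges packs two elements into one, so
   that the elements [x^* x] form a proper convex cone. *)
Lemma sum_star_mul x y :
  star (s0 i0 * x + s0 i1 * y) * (s0 i0 * x + s0 i1 * y) =
  star x * x + star y * y.
Proof.
rewrite starD !starM mulrDl !mulrDr !mulrA.
rewrite -!(mulrA (star x)) -!(mulrA (star y)).
rewrite !os0 !eqxx (negbTE i01) eq_sym (negbTE i01).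
by rewrite !mul1r !mul0r !mulr0 addr0 add0r.
Qed.

Lemma sum_star_mul_eq0 x y : star x * x + star y * y = 0 -> x = 0.
Proof.
rewrite -sum_star_mul => /star_mul_eq0 /(congr1 (fun u => star (s0 i0) * u)).
rewrite mulrDr !mulrA !os0 eqxx (negbTE i01).
by rewrite mul1r mul0r addr0 mulr0.
Qed.

(** The elements [y' y - h] with [h] in [N] form a cone, by packing two squares into one, and it
    contains [- 1] exactly when some [1 + y' y] lies in [N]. The state of a total extension is
    nonnegative at each self-adjoint [- h]. *)
Lemma exists_state N : convex_cone N -> N 0 ->
  (forall h x, N h -> 1 + star x * x <> h) ->
  exists2 w : A -> R[i], is_state w &
    forall h, N h -> star h = h -> w h <= 0.
Proof.
move=> [ND NZ] N0 Nn.
pose K0 : set A := [set x | exists h y, N h /\ x = star y * y - h]%classic.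
have [||| K hK sK] := @total_cone_extension _ _ K0.
- split.
    move=> _ _ [h [y [Nh ->]]] [k [z [Nk ->]]].
    exists (h + k), (s0 i0 * y + s0 i1 * z); split; first exact: ND.
    by rewrite sum_star_mul addrACA opprD.
  move=> a _ a0 [h [y [Nh ->]]]; exists (a *: h), (sqrtC a *: y).
  split; first exact: NZ.
  rewrite starZ -scalerAl -scalerAr scalerA -normCKC ger0_norm ?sqrtC_ge0 //.
  by rewrite sqrtCK scalerBr.
- by move=> x; exists 0, x; rewrite subr0.
- move=> [h [y [Nh e]]]; apply: (Nn h y Nh).
  by rewrite -[h](subKr (star y * y)) -e opprK addrC.
have [w sw wpos] := cone_functional hK; exists w => // h Nh sh.
rewrite -oppr_ge0 -(formN (state_scalar sw)).
apply: wpos; first by rewrite starN sh.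
by apply: sK; exists h, 0; rewrite mulr0 add0r.
Qed.

End IsometricFrames.

(** * Orbits of the defect projection of an isometry *)

Section WanderingProjection.
Variables (C : numClosedFieldType) (A : cstarAlgebraType C) (v q : A).
Hypotheses (vv : star v * v = 1) (sq : star q = q) (qq : q * q = q).
Hypothesis svq : star v * q = 0.

Lemma wandering_mulr : q * v = 0.
Proof. by rewrite -[LHS]starK starM sq svq star0. Qed.

Definition orbit_sum m := \sum_(k < m) v ^+ k * q.

Lemma orbit_sumS m : orbit_sum m.+1 = q + v * orbit_sum m.
Proof.
rewrite /orbit_sum big_ord_recl expr0 mul1r mulr_sumr; congr (_ + _).
by apply: eq_bigr => k _; rewrite exprS mulrA.
Qed.

(** The terms [v^k q] have mutually orthogonal ranges, and each contributes [q]. *)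
Lemma star_mul_orbit_sum m : star (orbit_sum m) * orbit_sum m = m%:R *: q.
Proof.
elim: m => [|m IH]; first by rewrite /orbit_sum big_ord0 mulr0 scale0r.
rewrite orbit_sumS starD starM sq mulrDl !mulrDr qq !mulrA wandering_mulr.
rewrite mul0r addr0 -(mulrA _ _ q) svq mulr0 add0r -(mulrA _ _ v) vv mulr1 IH.
by rewrite -{1}[q]scale1r -scalerDl -natr1 addrC.
Qed.

Lemma orbit_sum_almost_fixed m :
  (1 - v) * orbit_sum m = q - v ^+ m * q.
Proof.
rewrite mulrBl mul1r -[X in _ - X](addKr q) -orbit_sumS /orbit_sum.
by rewrite big_ord_recr /= opprD opprK addrCA opprD addNKr.
Qed.

(** Under [1 - v] the orbit sum telescopes to its two end terms, so the result stays at [2 q] while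
    the square of the sum grows with [m]. The successor keeps the end terms [q] and [v^(m+1) q]
    distinct and orthogonal. *)
Lemma orbit_sum_compress m :
  star (orbit_sum m.+1) * (star (1 - v) * (1 - v)) * orbit_sum m.+1 = 2 *: q.
Proof.
rewrite mulrA -mulrA -starM orbit_sum_almost_fixed starB starM sq.
have vm : star (v ^+ m.+1) * v ^+ m.+1 = 1.
  elim: m.+1 => [|k IH]; first by rewrite expr0 star1 mulr1.
  by rewrite exprS starM mulrA -(mulrA _ _ v) vv mulr1.
have qvm : q * v ^+ m.+1 = 0 by rewrite exprS mulrA wandering_mulr mul0r.
have svm : star (v ^+ m.+1) * q = 0 by rewrite -[q]sq -starM qvm star0.
rewrite mulrBl !mulrBr qq mulrA qvm mul0r subr0 -mulrA svm mulr0 sub0r opprK.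
by rewrite -mulrA (mulrA (star _)) vm mul1r qq scaler_nat mulr2n.
Qed.

End WanderingProjection.

Section IsometryFixedByState.
Variables (R : realType) (A : cstarAlgebraType R[i]).
Variables (J : finType) (t : J -> A) (a b : J) (z : J -> R[i]).
Hypotheses (ot : orthonormal_family t) (ab : a != b).
Hypothesis z1 : \sum_j `|z j| ^+ 2 = 1.

Let v := \sum_j z j *: t j.
Let q := 1 - v * star v.
Let h := star (1 - v) * (1 - v).

Lemma star_frame_mul j : star v * t j = (z j)^* *: 1.
Proof.
rewrite star_sum mulr_suml (bigD1 j) //= big1 => [|i ij].
  by rewrite starZ -scalerAl ot eqxx addr0.
by rewrite starZ -scalerAl ot (negbTE ij) scaler0.
Qed.

Lemma frame_isometry : star v * v = 1.
Proof.
rewrite {2}/v mulr_sumr.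
under eq_bigr do rewrite -scalerAr star_frame_mul scalerA -normCK.
by rewrite -scaler_suml z1 scale1r.
Qed.

Let star_q : star q = q.
Proof. by rewrite starB star1 starM starK. Qed.

Let svq : star v * q = 0.
Proof. by rewrite mulrBr mulr1 mulrA frame_isometry mul1r subrr. Qed.

Let qq : q * q = q.
Proof. by rewrite {1}/q mulrBl mul1r -mulrA svq mulr0 subr0. Qed.

(** If [v] were unitary, every [t_j = v v' t_j] would be a multiple of [v]; orthogonality of [t_a]
    and [t_b] would then make one of them zero. *)
Let q_neq0 : q <> 0.
Proof.
move/eqP; rewrite subr_eq0 => /eqP vv.
have tv j : t j = (z j)^* *: v.
  by rewrite -[LHS]mul1r vv -mulrA star_frame_mul -scalerAr mulr1.
have tn j : t j <> 0.
  move=> tj; have := ot j j; rewrite tj mulr0 eqxx => /esym/eqP.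
  by rewrite oner_eq0.
have := ot a b; rewrite (negbTE ab) {1}tv (tv b) starZ -scalerAl -scalerAr.
rewrite frame_isometry scalerA => /eqP; rewrite scaler_eq0 oner_eq0 orbF.
rewrite conjCK mulf_eq0 conjC_eq0 => /orP[] /eqP z0.
  by apply: (tn a); rewrite tv z0 conjC0 scale0r.
by apply: (tn b); rewrite tv z0 conjC0 scale0r.
Qed.

(** Compressing [1 + x' x = l h] by an orbit sum [y] gives [(m + 1) q + (x y)' (x y) = 2 l q]. For
    [m + 1 > 2 l] a positive multiple of [q] plus a square vanishes, so [q = 0]. *)
Let no_lower_bound (l : R[i]) x : 0 <= l -> 1 + star x * x <> l *: h.
Proof.
move=> l0 e; have [|m hm] := @complex_archi _ (2 * l).
  by rewrite ger0_real // mulr_ge0.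
have {}hm : 2 * l < m.+1%:R by apply: lt_trans hm _; rewrite ltr_nat.
pose y := orbit_sum v q m.+1.
have := congr1 (fun u => star y * u * y) e.
rewrite mulrDr mulr1 mulrDl star_mul_orbit_sum ?frame_isometry //.
rewrite -scalerAr -scalerAl orbit_sum_compress ?frame_isometry //.
rewrite scalerA mulrC => /eqP; rewrite -subr_eq0 addrAC -scalerBl => /eqP.
have c0 : 0 < m.+1%:R - 2 * l by rewrite subr_gt0.
move: c0; set c := _ - _ => c0.
have -> : c *: q = star (sqrtC c *: q) * (sqrtC c *: q).
  rewrite starZ star_q -scalerAl -scalerAr qq scalerA -normCKC.
  by rewrite ger0_norm ?sqrtC_ge0 ?ltW // sqrtCK.
have -> : star y * (star x * x) * y = star (x * y) * (x * y).
  by rewrite starM !mulrA.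
move/(sum_star_mul_eq0 ot ab)/eqP; rewrite scaler_eq0 sqrtC_eq0 gt_eqF //=.
by move/eqP.
Qed.

(** A state that is nonpositive on the ray of [h] is null there, hence takes equal values at [y v]
    and [y] for every [y]; the choice [y = t_j'] picks out the coefficient [z_j]. *)
Lemma exists_frame_state : exists2 w : A -> R[i], is_state w &
  forall j, w (t j) = (z j)^*.
Proof.
pose N : set A := [set x | exists2 l : R[i], 0 <= l & x = l *: h]%classic.
have [|||w sw wN] := @exists_state _ _ _ t a b ot ab N.
- split.
    by move=> _ _ [l l0 ->] [k k0 ->]; exists (l + k);
      rewrite ?addr_ge0 ?scalerDl.
  by move=> c _ c0 [l l0 ->]; exists (c * l); rewrite ?mulr_ge0 ?scalerA.
- by exists 0; rewrite ?scale0r.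
- by move=> _ x [l l0 ->]; exact: no_lower_bound.
exists w => // j.
have wh : w h = 0.
  apply/le_anti; rewrite state_ge0 // andbT wN ?starM ?starK //.
  by exists 1; rewrite ?scale1r.
have := state_null sw (star (t j)) wh.
rewrite mulrBr mulr1 (formB (state_scalar sw)) => /eqP; rewrite subr_eq0.
rewrite -[v]starK -starM star_frame_mul starZ star1 conjCK => /eqP.
rewrite state_star // (formZ (state_scalar sw)) (state1 sw) mulr1 => e.
by rewrite -e conjCK.
Qed.

End IsometryFixedByState.

(** * Eigenvalue relations of states *)

Section StateEigenvalue.
Variables (C : numClosedFieldType) (A : cstarAlgebraType C) (w : A -> C).
Hypothesis hw : is_state w.

Definition eigen_defect (t : A) (z : C) : A := star t - z *: 1.

Lemma eigen_defectE t z : w (star (eigen_defect t z) * eigen_defect t z) =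
  w (t * star t) - z * w t - z^* * (w t)^* + `|z| ^+ 2.
Proof.
rewrite /eigen_defect -scaleNr (form_sesquilinear (state_scalar hw)).
rewrite starK star1 mulr1 mul1r mulr1 (state1 hw) mulr1 rmorphN normrN.
by rewrite !mulNr (state_star hw).
Qed.

Lemma eigen_mulr t z : w (star (eigen_defect t z) * eigen_defect t z) = 0 ->
  forall x, w (x * star t) = z * w x.
Proof.
move=> h x; have := state_null hw x h.
rewrite mulrBr -scalerAr mulr1 (formB (state_scalar hw)).
by rewrite (formZ (state_scalar hw)) => /eqP; rewrite subr_eq0 => /eqP.
Qed.

Lemma eigen_mull t z : w (star (eigen_defect t z) * eigen_defect t z) = 0 ->
  forall x, w (t * x) = z^* * w x.
Proof.
move=> h x; rewrite -[t * x]starK starM (state_star hw) (eigen_mulr h).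
by rewrite rmorphM /= (state_star hw) conjCK.
Qed.

Lemma eigen_value t z : w (star (eigen_defect t z) * eigen_defect t z) = 0 ->
  w t = z^*.
Proof. by move=> /eigen_mull /(_ 1); rewrite mulr1 (state1 hw) mulr1. Qed.

(** Each defect has value [w (t_j t_j') - |z_j|^2], which is nonnegative. As [1 - sum_j t_j t_j'] is
    a projection, all these values together, hence each of them, are bounded by
    [1 - sum_j |z_j|^2]. *)
Lemma eigen_defect_le (J : finType) (t : J -> A) (z : J -> C) (i : J) :
  (forall i j, star (t i) * t j = (i == j)%:R) ->
  (forall j, w (t j) = (z j)^*) ->
  w (star (eigen_defect (t i) (z i)) * eigen_defect (t i) (z i)) <=
  1 - \sum_j `|z j| ^+ 2.
Proof.
move=> ot wt; pose p := 1 - \sum_j t j * star (t j).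
have tp j : star (t j) * p = 0.
  rewrite mulrBr mulr1 mulr_sumr (bigD1 j) //= big1 => [|l lj].
    by rewrite mulrA ot eqxx mul1r addr0 subrr.
  by rewrite mulrA ot eq_sym (negbTE lj) mul0r.
have pp : star p * p = p.
  have -> : star p = p.
    rewrite starB star1 star_sum; congr (_ - _).
    by apply: eq_bigr => j _; rewrite starM starK.
  rewrite {1}/p mulrBl mul1r mulr_suml big1 ?subr0 // => j _.
  by rewrite -mulrA tp mulr0.
have := state_ge0 hw p; rewrite pp (formB (state_scalar hw)) (state1 hw).
rewrite (form_sum (state_scalar hw)) subr_ge0 => wp.
apply: (@le_trans _ _ (\sum_j w (t j * star (t j)) - \sum_j `|z j| ^+ 2));
  last first.
  by rewrite lerD2r.
have E j : w (star (eigen_defect (t j) (z j)) * eigen_defect (t j) (z j)) =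
    w (t j * star (t j)) - `|z j| ^+ 2.
  by rewrite eigen_defectE wt conjCK normCK; ring.
rewrite -sumrB (bigD1 i) //= E lerDl sumr_ge0 // => j _.
by rewrite -E state_ge0.
Qed.

(* A convex combination of states can only vanish on a positive element where
   both states do. *)
Lemma pure_of_unique_null (J : Type) (x : J -> A) :
  (forall j, w (star (x j) * x j) = 0) ->
  (forall w', is_state w' -> (forall j, w' (star (x j) * x j) = 0) -> w' = w) ->
  is_pure_state w.
Proof.
move=> wx uniq; split=> // l w1 w2 s1 s2 /andP[l0 l1] e.
have l1' : 0 < 1 - l by rewrite subr_gt0.
split; apply: uniq => // j; have := e (star (x j) * x j); rewrite wx => /esym.
all: have p1 := state_ge0 s1 (x j); have p2 := state_ge0 s2 (x j).
all: move/eqP; rewrite paddr_eq0 ?mulr_ge0 ?(ltW l0) ?(ltW l1') //.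
all: rewrite !mulf_eq0 (gt_eqF l0) (gt_eqF l1') /=.
all: by case/andP => /eqP ? /eqP ?.
Qed.

End StateEigenvalue.

(** * Words in the generators *)

Section CuntzWords.
Variables (C : numClosedFieldType) (n : nat) (A : cstarAlgebraType C).
Variable (s : 'I_n -> A).
Hypotheses (rs : cuntz_relations s) (gs : cstar_generates s).

Definition word (I : seq 'I_n) : A := \prod_(i <- I) s i.

Definition closed_subspace (L : set A) : Prop :=
  (forall (a : C) x y, L x -> L y -> L (a *: x + y)) /\ cnorm_closed L.

(** The elements that, along with their adjoints, preserve the closed span [W] of the [s_I s_J']
    under left multiplication form a closed star-subalgebra containing the generators. So all of [A]
    preserves [W], and [1] lies in [W]. *)
Lemma cuntz_words_dense (L : set A) : closed_subspace L ->
  (forall I J, L (word I * star (word J))) -> forall x, L x.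
Proof.
move=> cL wL.
pose W : set A := [set x | forall L, closed_subspace L ->
  (forall I J, L (word I * star (word J))) -> L x]%classic.
have Wlin a x y : W x -> W y -> W (a *: x + y).
  by move=> Wx Wy L' cL' wL'; apply: cL'.1; [exact: Wx|exact: Wy].
have Wcl : cnorm_closed W.
  move=> x hx L' cL' wL'; apply: cL'.2 => e /hx [y Wy ye].
  by exists y => //; exact: Wy.
have Ww I J : W (word I * star (word J)) by move=> L' _.
have W0 : W 0 by move: (Wlin (-1) _ _ (Ww [::] [::]) (Ww [::] [::]));
  rewrite scaleN1r addNr.
pose stable a := forall x, W x -> W (a * x).
have stable_words a : (forall I J, W (a * (word I * star (word J)))) ->
  stable a.
  move=> ha x /(_ [set y | W (a * y)]%classic); apply; last exact: ha.
  split=> [b y1 y2 /= W1 W2|y hy /=].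
    by rewrite mulrDr -scalerAr; exact: Wlin.
  apply: Wcl => e e0; have a0 : 0 < cnorm a + 1 by rewrite ltr_wpDl ?cnorm_ge0.
  have [|y' Wy' yy'] := hy (e / (cnorm a + 1)); first by rewrite divr_gt0.
  exists (a * y') => //; rewrite -mulrBr; apply: le_lt_trans (ler_cnormM _ _) _.
  rewrite ltr_pdivlMr // mulrC in yy'; apply: le_lt_trans yy'.
  by rewrite ler_wpM2r ?cnorm_ge0 // lerDl.
have stable_gen i : stable (s i).
  apply: stable_words => I J.
  by have := Ww (i :: I) J; rewrite /word big_cons -mulrA.
have stable_star i : stable (star (s i)).
  (* On an empty left word the new [s_i'] joins the adjoint word, at the end of [J] because [star]
     reverses products; otherwise [s_i' s_j] cancels to [0] or [1]. *)
  apply: stable_words => -[|j I] J.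
    have := Ww [::] (rcons J i).
    by rewrite /word big_nil !mul1r big_rcons /= starM.
  rewrite /word big_cons !mulrA rs.1; case: eqP => _.
    by rewrite mul1r; exact: Ww.
  by rewrite !mul0r.
have stable_lin (a : C) x y : stable x -> stable y -> stable (a *: x + y).
  move=> hx hy u Wu; rewrite mulrDl -scalerAl.
  by apply: Wlin; [exact: hx|exact: hy].
have stable_mul x y : stable x -> stable y -> stable (x * y).
  by move=> hx hy u Wu; rewrite -mulrA; exact: (hx _ (hy _ Wu)).
have stable_closed x : (forall e : C, 0 < e -> exists2 y, stable y &
    cnorm (x - y) < e) -> stable x.
  move=> hx u Wu; apply: Wcl => e e0.
  have u0 : 0 < cnorm u + 1 by rewrite ltr_wpDl ?cnorm_ge0.
  have [|y Wy xy] := hx (e / (cnorm u + 1)); first by rewrite divr_gt0.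
  exists (y * u); first exact: Wy.
  rewrite -mulrBl; apply: le_lt_trans (ler_cnormM _ _) _.
  rewrite ltr_pdivlMr // in xy; apply: le_lt_trans xy.
  by rewrite ler_wpM2l ?cnorm_ge0 // lerDl.
pose S : set A := [set a | stable a /\ stable (star a)]%classic.
have ST : S = setT.
  apply: gs => [|x hx|i]; last by split.
    split.
    - by split; rewrite ?star1 => x; rewrite mul1r.
    - move=> a x y [x1 x2] [y1 y2]; split; first exact: stable_lin.
      by rewrite starD starZ; exact: stable_lin.
    - move=> x y [x1 x2] [y1 y2]; split; first exact: stable_mul.
      by rewrite starM; exact: stable_mul.
    - by move=> x [x1 x2]; split; rewrite ?starK.
  split; apply: stable_closed => e /hx [y [y1 y2] xy]; first by exists y.
  by exists (star y); rewrite // -starB cnorm_star.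
move=> x; have [hx _] : S x by rewrite ST.
have := hx 1; rewrite mulr1; apply => //.
by have := Ww [::] [::]; rewrite /word big_nil mul1r star1.
Qed.

End CuntzWords.

(** * The isometries of a geometric progression *)

Section GeometricFrame.
Variables (C : numClosedFieldType) (A : cstarAlgebraType C).
Variables (n : nat) (hn : (1 < n)%N) (s : 'I_n -> A).
Hypothesis rs : cuntz_relations s.

Let sn : A := s (last_index hn).
Let s' (i : 'I_n.-1) : A := s (widen_ord (leq_pred n) i).

Let star_sn_s' i : star sn * s' i = 0.
Proof.
rewrite rs.1; case: eqP => // /(congr1 val) /= e.
by have := ltn_ord i; rewrite -e ltnn.
Qed.

Let star_s'_sn i : star (s' i) * sn = 0.
Proof. by rewrite -[LHS]starK starM starK star_sn_s' star0. Qed.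

Lemma star_expn_mul r d : star (sn ^+ r) * sn ^+ (r + d) = sn ^+ d.
Proof.
elim: r => [|r IH]; first by rewrite expr0 star1 mul1r.
by rewrite addSn !exprS starM mulrA -(mulrA _ _ sn) rs.1 eqxx mulr1.
Qed.

Let gp_ortho_lt r q i j : (r < q)%N ->
  star (sn ^+ r * s' i) * (sn ^+ q * s' j) = 0.
Proof.
move=> /subnKC <-; rewrite addSnnS starM mulrA -(mulrA _ _ (sn ^+ _)).
by rewrite star_expn_mul exprS mulrA star_s'_sn !mul0r.
Qed.

Lemma gp_ortho r q i j : star (sn ^+ r * s' i) * (sn ^+ q * s' j) =
  ((r == q) && (i == j))%:R.
Proof.
have [rq|rq|<-] /= := ltngtP r q; first exact: gp_ortho_lt.
  by rewrite -[LHS]starK starM starK gp_ortho_lt // star0.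
rewrite starM mulrA -(mulrA _ _ (sn ^+ _)) -{2}[r]addn0 star_expn_mul expr0.
by rewrite mulr1 rs.1 -val_eqE.
Qed.

Lemma gp_ortho_pow r k i : (r < k)%N -> star (sn ^+ r * s' i) * sn ^+ k = 0.
Proof.
move=> /subnKC <-; rewrite addSnnS starM -mulrA star_expn_mul exprS mulrA.
by rewrite star_s'_sn mul0r.
Qed.

Let cuntz_sum : \sum_i s' i * star (s' i) + sn * star sn = 1.
Proof.
rewrite -rs.2 /s' /sn; case: n hn s => // m hm t.
rewrite big_ord_recr /=; congr (_ + _).
  by apply: eq_bigr => i _; congr (t _ * star (t _)); apply: val_inj.
by congr (t _ * star (t _)); apply: val_inj.
Qed.

(** The Cuntz relation, inserted between [sn ^+ L] and its adjoint, splits off the next layer. *)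
Lemma gp_resolution L :
  \sum_(a < L) \sum_i (sn ^+ a * s' i) * star (sn ^+ a * s' i)
    + sn ^+ L * star (sn ^+ L) = 1.
Proof.
elim: L => [|L IH]; first by rewrite big_ord0 add0r expr0 star1 mulr1.
rewrite big_ord_recr /= -[RHS]IH -addrA; congr (_ + _).
rewrite -[X in _ = X * _]mulr1 -cuntz_sum mulrDr mulrDl mulr_sumr mulr_suml.
rewrite exprSr starM !mulrA; congr (_ + _).
by apply: eq_bigr => i _; rewrite starM !mulrA.
Qed.

Definition gp_frame k (o : option ('I_k * 'I_n.-1)) : A :=
  if o is Some (r, i) then sn ^+ r * s' i else sn ^+ k.

(** The last coefficient is kept apart from the sequence [z], so that truncations of an infinite
    sequence can be completed by any [c]. *)
Definition gp_coef k (z : nat -> C) (c : C) (o : option ('I_k * 'I_n.-1)) : C :=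
  if o is Some (r, i) then z (n.-1 * r + i)%N else c.

Lemma gp_frame_ortho k i j :
  star (@gp_frame k i) * gp_frame j = (i == j)%:R.
Proof.
case: i j => [[r i]|] [[q j]|] /=.
- by rewrite gp_ortho.
- by rewrite gp_ortho_pow ?ltn_ord.
- by rewrite -[LHS]starK starM starK gp_ortho_pow ?ltn_ord // star0.
- by rewrite -{2}[k]addn0 star_expn_mul expr0.
Qed.

Lemma gp_sum_pairs k (F : nat -> C) :
  \sum_(p : 'I_k * 'I_n.-1) F (n.-1 * p.1 + p.2)%N =
    \sum_(0 <= j < n.-1 * k) F j.
Proof.
rewrite mulnC big_nat_mul big_mkord.
rewrite -(pair_bigA _ (fun (r : 'I_k) (i : 'I_n.-1) => F (n.-1 * r + i)%N)) /=.
apply: eq_bigr => r _.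
rewrite mulSn -{1}[(r * _)%N]add0n big_addn addnK big_mkord.
by apply: eq_bigr => i _; rewrite addnC mulnC.
Qed.

Lemma gp_sum_coef k z c :
  \sum_o `|@gp_coef k z c o| ^+ 2 =
    \sum_(0 <= j < n.-1 * k) `|z j| ^+ 2 + `|c| ^+ 2.
Proof.
rewrite -(gp_sum_pairs _ (fun j => `|z j| ^+ 2)) (bigD1 None) //= addrC.
congr (_ + _); rewrite (reindex_omap Some id) => [|[]] //=.
by apply: eq_big => [p|[r i] _] //=; rewrite eqxx.
Qed.

Section Uniqueness.
Variables (w1 w2 : A -> C).
Hypotheses (h1 : is_state w1) (h2 : is_state w2).

Let d x := w1 x - w2 x.

Let d_star x : d (star x) = (d x)^*.
Proof. by rewrite /d (state_star h1) (state_star h2) rmorphB. Qed.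

(* Left multiplication by a word acts on the difference of the two states as a
   scalar times left multiplication by a power of [sn] of reduced exponent. *)
Variable reduced : pred nat.
Hypothesis reduced0 : reduced 0.
Hypothesis reduce : forall r (i : 'I_n), reduced r -> exists c r', reduced r' /\
  forall x, w1 (sn ^+ r * s i * x) - w2 (sn ^+ r * s i * x) =
    c * (w1 (sn ^+ r' * x) - w2 (sn ^+ r' * x)).
Hypothesis powers : forall r q, reduced r -> reduced q ->
  w1 (sn ^+ r * star (sn ^+ q)) = w2 (sn ^+ r * star (sn ^+ q)).

Let reduce_word I : exists c r, reduced r /\
  forall x, d (word s I * x) = c * d (sn ^+ r * x).
Proof.
suff : forall r, reduced r -> exists c r', reduced r' /\
    forall x, d (sn ^+ r * word s I * x) = c * d (sn ^+ r' * x).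
  by move=> /(_ 0%N reduced0); rewrite expr0 mul1r.
elim: I => [|i I IH] r hr.
  by exists 1, r; split=> // x; rewrite /word big_nil mulr1 mul1r.
have [c [r' [hr' de]]] := reduce i hr.
have e x : d (sn ^+ r * s i * x) = c * d (sn ^+ r' * x) by exact: de.
have [c' [q [hq e']]] := IH _ hr'.
exists (c * c'), q; split=> // x.
rewrite /word big_cons mulrA -mulrA e -[RHS]mulrA -e'.
by rewrite -[in RHS]mulrA.
Qed.

(** [I] is reduced on the left; taking adjoints moves [J] to the left, where it is reduced in turn.
    Only the powers of [sn] remain. *)
Lemma words_agree I J : w1 (word s I * star (word s J)) =
  w2 (word s I * star (word s J)).
Proof.
apply/eqP; rewrite -subr_eq0 -/(d _).
have [c [r [hr ->]]] := reduce_word I; have [c' [q [hq e]]] := reduce_word J.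
rewrite -[sn ^+ r * _]starK starM starK d_star e.
by rewrite [d _]/d powers // subrr mulr0 rmorph0 mulr0.
Qed.

End Uniqueness.

Section Shift.
Variables (w1 w2 : A -> C) (z : nat -> 'I_n.-1 -> C) (L r q : nat).
Hypotheses (h1 : is_state w1) (h2 : is_state w2).
Hypothesis eig : forall w a i, w = w1 \/ w = w2 -> (a < maxn r q + L)%N ->
  w (star (eigen_defect (sn ^+ a * s' i) (z a i)) *
     eigen_defect (sn ^+ a * s' i) (z a i)) = 0.

(** The resolution of the unit inserted in the middle yields a finite sum fixed by the eigenvalues
    common to both states; it cancels in the difference. *)
Lemma diff_shift :
  w1 (sn ^+ r * star (sn ^+ q)) - w2 (sn ^+ r * star (sn ^+ q)) =
  w1 (sn ^+ (r + L) * star (sn ^+ (q + L))) -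
  w2 (sn ^+ (r + L) * star (sn ^+ (q + L))).
Proof.
have E w : is_state w -> w = w1 \/ w = w2 -> w (sn ^+ r * star (sn ^+ q)) =
    \sum_(a < L) \sum_i (z (r + a)%N i)^* * z (q + a)%N i +
    w (sn ^+ (r + L) * star (sn ^+ (q + L))).
  move=> hw ww.
  rewrite -[X in w (X * _)]mulr1 -(gp_resolution L) mulrDr mulrDl.
  rewrite (formD (state_scalar hw)); congr (_ + w _); last first.
    by rewrite !exprD starM !mulrA.
  rewrite mulr_sumr mulr_suml (form_sum (state_scalar hw)).
  apply: eq_bigr => a _.
  rewrite mulr_sumr mulr_suml (form_sum (state_scalar hw)).
  apply: eq_bigr => i _.
  have -> :
      sn ^+ r * (sn ^+ a * s' i * star (sn ^+ a * s' i)) * star (sn ^+ q) =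
      (sn ^+ (r + a) * s' i) * star (sn ^+ (q + a) * s' i).
    by rewrite !exprD !starM !mulrA.
  rewrite (eigen_mull hw (eig _ ww _)); last first.
    by rewrite -addnS leq_add ?leq_maxl ?ltn_ord.
  rewrite -[star (sn ^+ (q + a) * _)]mul1r (eigen_mulr hw (eig _ ww _)).
    by rewrite (state1 hw) mulr1.
  by rewrite -addnS leq_add ?leq_maxr ?ltn_ord.
rewrite (E _ h1 (or_introl erefl)) (E _ h2 (or_intror erefl)).
by rewrite opprD addrACA subrr add0r.
Qed.

End Shift.

End GeometricFrame.

(** * Geometric progression states *)

Lemma unit_vector_sum (C : numClosedFieldType) m (z : 'rV[C]_m.+1) :
  unit_vector z ->
  \sum_(0 <= j < m) `|z 0 (inord j)| ^+ 2 + `|z 0 ord_max| ^+ 2 = 1.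
Proof.
move=> <-; rewrite big_ord_recr /= big_mkord; congr (_ + _).
apply: eq_bigr => j _; congr (`|z 0 _| ^+ 2); apply: val_inj.
by rewrite /= inordK // ltnS ltnW.
Qed.

Import numFieldNormedType.Exports.

Lemma unit_l2_dist (C : numClosedFieldType) (z : nat -> C) (e : C) :
  unit_l2 z -> 0 < e -> exists N, forall M, (N <= M)%N ->
    `|1 - \sum_(0 <= j < M) `|z j| ^+ 2| < e.
Proof. by rewrite /unit_l2 => /cvgrPdist_lt /[apply] -[N _ hN]; exists N. Qed.

Section GeometricProgressionStates.
Variables (R : realType) (n : nat) (hn : (1 < n)%N).
Variables (A : cstarAlgebraType R[i]) (s : 'I_n -> A).
Hypotheses (rs : cuntz_relations s) (gs : cstar_generates s).

Let sn : A := s (last_index hn).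
Let s' (i : 'I_n.-1) : A := s (widen_ord (leq_pred n) i).

Let n1_gt0 : (0 < n.-1)%N. Proof. by case: n hn => [|[]]. Qed.

Lemma states_eq_on_words w1 w2 : is_state w1 -> is_state w2 ->
  (forall I J, w1 (word s I * star (word s J)) =
    w2 (word s I * star (word s J))) ->
  w1 = w2 :> (A -> R[i]).
Proof.
move=> h1 h2 e; apply/funext => x.
have lw1 := state_scalar h1; have lw2 := state_scalar h2.
move: x; pose L : set A := [set x | w1 x = w2 x]%classic.
apply: (cuntz_words_dense rs gs (L := L)) => //.
split=> [a x y ex ey|x hx]; first by rewrite /L /= lw1 lw2 ex ey.
rewrite /L /=.
apply/eqP; rewrite -subr_eq0 -normr_eq0; apply/negPn/negP => d0.
have {}d0 : 0 < `|w1 x - w2 x| by rewrite lt_neqAle normr_ge0 eq_sym d0.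
(* Each of the two states contributes [2 cnorm (x - y)], hence the divisor [4]. *)
have [|y /= ey xy] := hx (`|w1 x - w2 x| / 4); first by rewrite divr_gt0.
suff /le_lt_trans /(_ (_ : _ < `|w1 x - w2 x|)) :
  `|w1 x - w2 x| <= cnorm (x - y) * 4.
  by rewrite -ltr_pdivlMr // => /(_ xy); rewrite ltxx.
have -> : w1 x - w2 x = w1 (x - y) - w2 (x - y).
  by rewrite (formB lw1) (formB lw2) ey opprB addrA subrK.
apply: le_trans (ler_normB _ _) _.
have -> : cnorm (x - y) * 4 = 2 * cnorm (x - y) + 2 * cnorm (x - y) by ring.
by rewrite lerD ?state_bound.
Qed.

Let last_or (i : 'I_n) : i = last_index hn \/
  exists j, i = widen_ord (leq_pred n) j.
Proof.
have [ltn1|gen1] := ltnP i n.-1.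
  by right; exists (Ordinal ltn1); apply: val_inj.
left; apply: val_inj => /=; apply/eqP; rewrite eqn_leq gen1 andbT.
by rewrite -ltnS prednK ?ltn_ord // ltnW.
Qed.

Definition null_on_frame k (z : nat -> R[i]) (c : R[i])
    (w : A -> R[i]) : Prop :=
  forall o, let D := eigen_defect (gp_frame hn s (k := k) o) (gp_coef z c o) in
    w (star D * D) = 0.

Lemma unit_frame_null k z c w : is_state w ->
  \sum_(0 <= j < n.-1 * k) `|z j| ^+ 2 + `|c| ^+ 2 = 1 ->
  (forall o : option ('I_k * 'I_n.-1),
    w (gp_frame hn s o) = (gp_coef z c o)^*) ->
  null_on_frame k z c w.
Proof.
move=> hw u wo o; apply/le_anti; rewrite state_ge0 // andbT.
have := @eigen_defect_le _ _ _ hw _ _ _ o (gp_frame_ortho hn rs (k := k)) wo.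
by rewrite gp_sum_coef u subrr.
Qed.

Lemma null_on_frame_unique k z c w1 w2 : (0 < k)%N -> `|c| < 1 ->
  is_state w1 -> is_state w2 ->
  null_on_frame k z c w1 -> null_on_frame k z c w2 -> w1 = w2.
Proof.
move=> k0 c1 h1 h2 n1 n2; apply: states_eq_on_words => //.
have nw w : w = w1 \/ w = w2 -> is_state w /\ null_on_frame k z c w.
  by case=> ->.
pose d x := w1 x - w2 x.
have d_star x : d (star x) = (d x)^*.
  by rewrite /d (state_star h1) (state_star h2) rmorphB.
have eig w a i (ak : (a < k)%N) : w = w1 \/ w = w2 ->
    w (star (eigen_defect (sn ^+ a * s' i) (z (n.-1 * a + i)%N)) *
       eigen_defect (sn ^+ a * s' i) (z (n.-1 * a + i)%N)) = 0.
  by move=> /nw [_ /(_ (Some (Ordinal ak, i)))].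
(* A shift by [k - q] turns the right factor into [star (sn ^+ k)], where both states have
   eigenvalue [c]. *)
have shift r q : (r <= q)%N -> (q <= k)%N ->
    d (sn ^+ r * star (sn ^+ q)) = c * d (sn ^+ (k - (q - r))).
  move=> rq qk; rewrite /d (@diff_shift _ _ _ hn s rs _ _
    (fun a i => z (n.-1 * a + i)%N) (k - q)) //; last first.
    by move=> w a i ww; rewrite (maxn_idPr rq) subnKC // => ak; exact: eig.
  rewrite subnKC // (_ : (r + (k - q) = k - (q - r))%N); last first.
    by rewrite subnBA // addnC addnBAC.
  have /= e1 := eigen_mulr h1 (n1 None); have /= e2 := eigen_mulr h2 (n2 None).
  by rewrite e1 e2 mulrBr.
(* Using [shift] twice, from [e] to [k - e] and back, multiplies the conjugate of [d (sn ^+ e)] by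
   [|c|^2 < 1]. *)
have powers0 e : (e <= k)%N -> d (sn ^+ e) = 0.
  move=> ek; have H m : (m <= k)%N -> (d (sn ^+ m))^* = c * d (sn ^+ (k - m)).
    by move=> mk; rewrite -d_star -[star _]mul1r -[1](expr0 sn) shift // subn0.
  have := H _ ek.
  rewrite -[d (sn ^+ (k - e))]conjCK (H _ (leq_subr _ _)) subKn //.
  rewrite rmorphM /= mulrA -normCK => /eqP.
  rewrite -subr_eq0 -{1}[(d _)^*]mul1r -mulrBl mulf_eq0 conjC_eq0 =>
    /orP[|/eqP//].
  by rewrite subr_eq0 eq_sym sqrf_eq1 lt_eqF //= eq_sym lt_eqF //
    (lt_le_trans _ (normr_ge0 _)) ?ltrN10.
apply: (@words_agree _ _ _ hn s _ _ h1 h2 (fun r => r < k)%N) => //.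
- move=> r i rk; have [->|[j ->]] := last_or i; last first.
    exists (z (n.-1 * r + j)%N)^*, 0%N; split=> // x.
    rewrite expr0 mul1r mulrBr (eigen_mull h1 (eig _ _ _ rk _)); last by left.
    by rewrite (eigen_mull h2 (eig _ _ _ rk _)) //; right.
  (* At [r + 1 = k] the eigenvalue of [sn ^+ k] resets the exponent to [0]. *)
  move: (rk); rewrite leq_eqVlt => /orP[/eqP rk'|rk'].
    exists c^*, 0%N; split=> // x.
    rewrite -exprSr rk' expr0 mul1r mulrBr.
    by rewrite (eigen_mull h1 (n1 None)) (eigen_mull h2 (n2 None)).
  by exists 1, r.+1; split=> // x; rewrite -exprSr mul1r.
- move=> r q rk qk; apply/eqP; rewrite -subr_eq0 -/(d _).
  have [rq|/ltnW qr] := leqP r q.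
    by rewrite shift ?powers0 ?mulr0 ?leq_subr // ltnW.
  rewrite -[_ * _]starK starM starK d_star shift ?(ltnW rk) //.
  by rewrite powers0 ?leq_subr // mulr0 conjC0.
Qed.

(** Nullity on the defects is the form of the condition that passes to the terms of a convex
    combination and yields the multiplicative relations. *)
Lemma gp_stateP k (z : 'rV[R[i]]_(n.-1 * k).+1) w : unit_vector z ->
  gp_state hn s z w <->
  is_state w /\ null_on_frame k (fun j => z 0 (inord j)) (z 0 ord_max) w.
Proof.
move=> uz; split=> [[hw w1 w2]|[hw w0]].
  split=> //; apply: unit_frame_null => // [|[[r i]|]] //; last exact: w1.
  exact: unit_vector_sum.
split=> // [r i|]; first exact: eigen_value hw _ _ (w0 (Some (r, i))).
exact: eigen_value hw _ _ (w0 None).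
Qed.

Lemma exists_state_null_on_frame k z c : (0 < k)%N ->
  \sum_(0 <= j < n.-1 * k) `|z j| ^+ 2 + `|c| ^+ 2 = 1 ->
  exists2 w, is_state w & null_on_frame k z c w.
Proof.
move=> k0 u; have [|||w hw wo] :=
  @exists_frame_state _ _ _ (gp_frame hn s (k := k))
  None (Some (Ordinal k0, Ordinal n1_gt0)) (gp_coef z c).
- exact: gp_frame_ortho.
- by [].
- by rewrite gp_sum_coef.
by exists w => //; exact: unit_frame_null.
Qed.

(** The generators themselves form a frame; the unit vector is concentrated at the last one. *)
Lemma exists_state_last_eigenvalue (a : R[i]) : `|a| = 1 ->
  exists w, [/\ is_state w, forall x, w (sn * x) = a * w x &
    forall i, w (s' i) = 0].
Proof.
move=> a1; pose z (i : 'I_n) := if i == last_index hn then a^* else 0.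
have zu : \sum_i `|z i| ^+ 2 = 1.
  rewrite (bigD1 (last_index hn)) //= big1 => [|i /negbTE il].
    by rewrite /z eqxx norm_conjC a1 expr1n addr0.
  by rewrite /z il normr0 expr0n.
pose i0 := widen_ord (leq_pred n) (Ordinal n1_gt0).
have li : last_index hn != i0.
  by rewrite -val_eqE /= gt_eqF.
have [w hw wz] := exists_frame_state rs.1 li zu; exists w; split=> // [x|i];
  last first.
  by rewrite wz /z -val_eqE /= ltn_eqF ?ltn_ord // conjC0.
have w0 : w (star (eigen_defect sn a^*) * eigen_defect sn a^*) = 0.
  apply/le_anti; rewrite state_ge0 // andbT.
  have := eigen_defect_le hw (last_index hn) rs.1 wz.
  by rewrite zu subrr /z eqxx.
by rewrite (eigen_mull hw w0) conjCK.
Qed.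

Lemma gp_state_not_unique k (z : 'rV[R[i]]_(n.-1 * k).+1) : (1 < k)%N ->
  unit_vector z -> `|z 0 ord_max| = 1 ->
  exists w1 w2, [/\ gp_state hn s z w1, gp_state hn s z w2 & w1 <> w2].
Proof.
move=> k1 uz zm; have k0 : (0 < k)%N by exact: ltnW.
(* The last coordinate exhausts the norm of [z]. *)
have z0 j : (j < n.-1 * k)%N -> z 0 (inord j) = 0.
  move=> jk; have := uz; rewrite /unit_vector big_ord_recr /= zm expr1n => /eqP.
  rewrite -subr_eq0 addrK psumr_eq0 => [/allP /(_ (Ordinal jk))|i _];
    last first.
    exact: exprn_ge0.
  rewrite mem_index_enum => /(_ isT); rewrite sqrf_eq0 normr_eq0 => /eqP <-.
  by congr (z 0 _); apply: val_inj; rewrite /= inordK // ltnS ltnW.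
have mk a : a ^+ k = (z 0 ord_max)^* ->
    exists2 w, gp_state hn s z w & w sn = a.
  move=> ak; have a1 : `|a| = 1.
    apply/eqP; rewrite -(@pexpr_eq1 _ _ k) // -normrX ak norm_conjC.
    exact/eqP.
  have [w [hw wa ws']] := exists_state_last_eigenvalue a1.
  have wX r x : w (sn ^+ r * x) = a ^+ r * w x.
    by elim: r => [|r IH]; rewrite ?expr0 ?mul1r // !exprS -!mulrA wa IH.
  exists w; last by rewrite -[sn]mulr1 wa (state1 hw) mulr1.
  split=> // [r i|]; last by rewrite -/sn -[sn ^+ k]mulr1 wX (state1 hw) mulr1.
  rewrite z0; last first.
    apply: (@leq_trans (n.-1 * r.+1)); first by rewrite mulnS addnC ltn_add2r.
    by rewrite leq_mul2l ltn_ord orbT.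
  by rewrite conjC0 wX ws' mulr0.
(* A root [m] of [1 + X + ... + X^(k-1)] is a [k]-th root of unity, and differs from [1], where the
   polynomial has value [k]. Then [a] and [m * a] are distinct [k]-th roots. *)
pose p : {poly R[i]} := \poly_(i < k) 1.
have sp : size p = k by rewrite size_poly_eq ?oner_eq0.
have /closed_rootP [m] : size p != 1%N by rewrite sp gtn_eqF.
rewrite /root horner_poly; under eq_bigr do rewrite mul1r; move=> /eqP m0.
have mk1 : m ^+ k = 1 by apply/eqP; rewrite -subr_eq0 subrX1 m0 mulr0.
have m1 : m != 1.
  apply: contra_eq_neq m0 => ->; under eq_bigr do rewrite expr1n.
  by rewrite sumr_const card_ord pnatr_eq0 -lt0n.
pose a := k.-root (z 0 ord_max)^*.
have ak : a ^+ k = (z 0 ord_max)^* by rewrite rootCK.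
have [w1 g1 e1] := mk _ ak.
have [|w2 g2 e2] := mk (m * a); first by rewrite exprMn mk1 mul1r.
exists w1, w2; split=> // /(congr1 (fun w => w sn)); rewrite e1 e2 => /eqP.
rewrite -{1}[a]mul1r -subr_eq0 -mulrBl mulf_eq0 subr_eq0 eq_sym (negbTE m1) /=.
have : a ^+ k != 0 by rewrite ak conjC_eq0 -normr_eq0 zm oner_eq0.
by rewrite expf_eq0 k0 /= => /negbTE ->.
Qed.

(** An excess over [1] would persist in all later partial sums, whose terms are nonnegative. *)
Lemma partial_sum_le1 (z : nat -> R[i]) N : unit_l2 z ->
  \sum_(0 <= j < N) `|z j| ^+ 2 <= 1.
Proof.
move=> uz; have S0 M : 0 <= \sum_(0 <= j < M) `|z j| ^+ 2.
  by rewrite sumr_ge0 // => j _; exact: exprn_ge0.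
rewrite real_leNgt ?ger0_real //; apply/negP; rewrite -subr_gt0.
move=> /(unit_l2_dist uz) [M /(_ (maxn M N) (leq_maxl _ _))];
  rewrite distrC => lt1.
have : \sum_(0 <= j < N) `|z j| ^+ 2 - 1 <
    \sum_(0 <= j < N) `|z j| ^+ 2 - 1; last by rewrite ltxx.
apply: le_lt_trans lt1; apply: le_trans (real_ler_norm _); last first.
  by rewrite realB ?ger0_real.
by rewrite lerD2r (big_cat_nat _ (leq_maxr M N)) //= lerDl sumr_ge0.
Qed.

Lemma partial_sum_cvg (z : nat -> R[i]) e : unit_l2 z -> 0 < e ->
  exists N, forall L, (N <= L)%N ->
    1 - \sum_(0 <= j < n.-1 * L) `|z j| ^+ 2 < e.
Proof.
move=> uz e0; have [N hN] := unit_l2_dist uz e0; exists N => L NL.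
have := hN (n.-1 * L)%N (leq_trans NL (leq_pmull _ n1_gt0)).
by rewrite ger0_norm // subr_ge0 partial_sum_le1.
Qed.

Definition null_infinite (z : nat -> R[i]) (w : A -> R[i]) : Prop :=
  forall p : nat * 'I_n.-1,
    let D := eigen_defect (sn ^+ p.1 * s' p.2) (z (n.-1 * p.1 + p.2)%N) in
    w (star D * D) = 0.

(** A finite family of the isometries bounds each of its defects by the missing mass
    [1 - sum |z_j|^2], which tends to zero as the family grows. *)
Lemma gp_state_infiniteP (z : nat -> R[i]) w : unit_l2 z ->
  gp_state_infinite hn s z w <-> is_state w /\ null_infinite z w.
Proof.
move=> uz; split=> [[hw wz]|[hw w0]]; last first.
  by split=> // r i; exact: eigen_value hw _ _ (w0 (r, i)).
split=> // -[r i]; apply/le_anti; rewrite state_ge0 // andbT.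
have D0 := state_ge0 hw (eigen_defect (sn ^+ r * s' i) (z (n.-1 * r + i)%N)).
rewrite real_leNgt ?ger0_real //; apply/negP => /(partial_sum_cvg uz) [N hN].
pose L := maxn N r.+1; have rL : (r < L)%N by exact: leq_maxr.
have := @eigen_defect_le _ _ _ hw _ (fun p : 'I_L * 'I_n.-1 =>
  sn ^+ p.1 * s' p.2)
  (fun p => z (n.-1 * p.1 + p.2)%N) (Ordinal rL, i).
rewrite (gp_sum_pairs _ _ (fun j => `|z j| ^+ 2)) /=.
have ot : forall p q : 'I_L * 'I_n.-1,
    star (sn ^+ p.1 * s' p.2) * (sn ^+ q.1 * s' q.2) = (p == q)%:R.
  by move=> [a x] [b y]; rewrite gp_ortho.
move=> /(_ ot (fun p => wz p.1 p.2)) /le_lt_trans /(_ (hN L (leq_maxl _ _))).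
by rewrite ltxx.
Qed.

Lemma null_infinite_unique (z : nat -> R[i]) w1 w2 : unit_l2 z ->
  is_state w1 -> is_state w2 -> null_infinite z w1 -> null_infinite z w2 ->
    w1 = w2.
Proof.
move=> uz h1 h2 n1 n2; apply: states_eq_on_words => //.
have nw w : w = w1 \/ w = w2 -> is_state w /\ null_infinite z w by case=> ->.
(* By the resolution of the unit, [sn ^+ m * star (sn ^+ m)] has as value the mass of [z] beyond
   [(n-1) m]. Cauchy-Schwarz bounds the mixed term by two such masses, one of which is estimated by
   [1]. *)
have tail w a b : w = w1 \/ w = w2 -> `|w (sn ^+ a * star (sn ^+ b))| ^+ 2 <=
    1 - \sum_(0 <= j < n.-1 * a) `|z j| ^+ 2.
  move=> /nw [hw w0]; have lw := state_scalar hw.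
  have wr m : w (sn ^+ m * star (sn ^+ m)) =
    1 - \sum_(0 <= j < n.-1 * m) `|z j| ^+ 2.
    rewrite -(state1 hw) -[in RHS](gp_resolution hn rs m) (formD lw).
    rewrite -(gp_sum_pairs _ _ (fun j => `|z j| ^+ 2)).
    rewrite -(pair_bigA _ (fun (r : 'I_m) (i : 'I_n.-1) =>
      `|z (n.-1 * r + i)%N| ^+ 2)) /=.
    rewrite (form_sum lw) addrAC -sumrB big1 ?add0r // => r _.
    rewrite (form_sum lw) -sumrB big1 // => i _; have nri := w0 (val r, i).
    by rewrite (eigen_mulr hw nri) (eigen_value hw nri) /= normCK subrr.
  have := state_cauchy_schwarz hw (star (sn ^+ b)) (star (sn ^+ a)).
  rewrite !starK => /le_trans; apply; rewrite !wr ler_piMl //.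
    by rewrite subr_ge0 partial_sum_le1.
  by rewrite gerBl sumr_ge0 // => j _; exact: exprn_ge0.
apply: (@words_agree _ _ _ hn s _ _ h1 h2 xpredT) => // [r i _|r q _ _].
  have [->|[j ->]] := last_or i.
    by exists 1, r.+1; split=> // x; rewrite -exprSr mul1r.
  exists (z (n.-1 * r + j)%N)^*, 0%N; split=> // x.
  rewrite expr0 mul1r mulrBr (eigen_mull h1 (n1 (r, j))).
  by rewrite (eigen_mull h2 (n2 (r, j))).
(* A shift by a large [N] leaves the difference unchanged, yet makes both terms smaller than half of
   it. *)
apply/eqP; rewrite -subr_eq0 -normr_eq0; apply/negPn/negP => d0.
set e := `|_| in d0; have {}d0 : 0 < e by rewrite lt_neqAle normr_ge0 eq_sym d0.
have e2 : 0 < e / 2 by rewrite divr_gt0.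
have [N hN] := partial_sum_cvg uz (exprn_gt0 2 e2).
have small w : w = w1 \/ w = w2 ->
  `|w (sn ^+ (r + N) * star (sn ^+ (q + N)))| < e / 2.
  move=> /tail tw.
  rewrite -(ltr_pXn2r (n := 2)) ?nnegrE ?normr_ge0 ?(ltW e2) //.
  apply: le_lt_trans (tw _ _) _; exact: hN (leq_addl _ _).
have : e < e; last by rewrite ltxx.
rewrite {1}/e (@diff_shift _ _ _ hn s rs _ _ (fun a i =>
  z (n.-1 * a + i)%N) N) //.
  apply: le_lt_trans (ler_normB _ _) _.
  by rewrite [ltRHS]splitr ltrD ?small //; [left|right].
by move=> w a i /nw [_ /(_ (a, i))].
Qed.

Lemma exists_state_null_infinite (z : nat -> R[i]) : unit_l2 z ->
  exists2 w, is_state w & null_infinite z w.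
Proof.
(* [c L] completes the first [(n-1) L] coordinates to a unit vector of order [L]. *)
move=> uz; pose c L := sqrtC (1 - \sum_(0 <= j < n.-1 * L) `|z j| ^+ 2).
have uL L : \sum_(0 <= j < n.-1 * L) `|z j| ^+ 2 + `|c L| ^+ 2 = 1.
  rewrite normCK geC0_conj ?sqrtC_ge0 ?subr_ge0 ?partial_sum_le1 //.
  by rewrite -expr2 sqrtCK addrC subrK.
(* Each [h] in [N] is null on a genuine state, of large finite order, so
   [1 + x' x = h] is impossible. *)
pose N : set A := [set h | exists L0, forall L w, (L0 <= L)%N -> is_state w ->
  null_on_frame L z (c L) w -> w h = 0]%classic.
pose i0 := widen_ord (leq_pred n) (Ordinal n1_gt0).
have li : last_index hn != i0 by rewrite -val_eqE /= gt_eqF.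
have [|||w hw wN] := @exists_state _ _ _ _ _ _ rs.1 li N.
- split=> [x y [L0 hx] [L1 hy]|a x _ [L0 hx]].
    exists (maxn L0 L1) => L w; rewrite geq_max => /andP[l0 l1] hw w0.
    by rewrite (formD (state_scalar hw)) (hx L) ?(hy L) // addr0.
  by exists L0 => L w l0 hw w0; rewrite (formZ (state_scalar hw)) (hx L) ?mulr0.
- by exists 0%N => L w _ hw _; exact: form0 (state_scalar hw).
- move=> y x [L0 hx] e; rewrite -{y}e in hx.
  have [w hw w0] := exists_state_null_on_frame (ltn0Sn L0) (uL L0.+1).
  have := hx _ w (leqnSn _) hw w0;
    rewrite (formD (state_scalar hw)) (state1 hw).
  move=> h; have : 0 < 1 + w (star x * x) by rewrite ltr_wpDr ?(state_ge0 hw).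
  by rewrite h ltxx.
exists w => // -[r i] D; apply/le_anti; rewrite state_ge0 // andbT.
apply: wN; last by rewrite starM starK.
(* The defect at [(r, i)] belongs to the frame of every order [L > r]. *)
by exists r.+1 => L w' rL _ /(_ (Some (Ordinal rL, i))).
Qed.

End GeometricProgressionStates.

Theorem theorem1p5 (R : realType) (n : nat) (hn : (2 <= n)%N)
    (A : cstarAlgebraType R[i]) (s : 'I_n -> A) (hs : is_cuntz_algebra s) :
  (forall (k : nat) (z : 'rV[R[i]]_(n.-1 * k).+1),
      (2 <= k)%N -> unit_vector z ->
      ((exists! w : A -> R[i], gp_state hn s z w) <-> `|z 0 ord_max| < 1) /\
      (`|z 0 ord_max| < 1 ->
         forall w : A -> R[i], gp_state hn s z w -> is_pure_state w)) /\
  (forall z : nat -> R[i], unit_l2 z ->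
      (exists! w : A -> R[i], gp_state_infinite hn s z w) /\
      (forall w : A -> R[i], gp_state_infinite hn s z w -> is_pure_state w)).
Proof.
case: hs => rs gs _; split=> [k z k2 uz|z uz].
  have k0 : (0 < k)%N by exact: ltnW.
  have uz' := unit_vector_sum uz.
  split; first split.
  - move=> [w [gw uw]].
    have zle1 : `|z 0 ord_max| <= 1.
      have : `|z 0 ord_max| ^+ 2 <= 1.
        by rewrite -uz' lerDr sumr_ge0 // => j _; exact: exprn_ge0.
      by rewrite expr_le1.
    rewrite lt_neqAle zle1 andbT; apply/eqP => z1.
    have [w1 [w2 [g1 g2]]] := gp_state_not_unique hn rs k2 uz z1.
    by rewrite -(uw _ g1) -(uw _ g2).
  - move=> z1; have [w hw w0] := exists_state_null_on_frame hn rs k0 uz'.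
    exists w; split; first by apply/gp_stateP.
    move=> w' /(gp_stateP hn rs _ uz) [hw' w0'].
    exact: (null_on_frame_unique rs gs k0 z1 hw hw' w0 w0').
  move=> z1 w /(gp_stateP hn rs _ uz) [hw w0].
  apply: (pure_of_unique_null hw (x := fun o : option ('I_k * 'I_n.-1) =>
    eigen_defect (gp_frame hn s o) (gp_coef _ _ o)) w0) => w' hw' w0'.
  exact: (null_on_frame_unique rs gs k0 z1 hw' hw w0' w0).
split.
  have [w hw w0] := exists_state_null_infinite hn rs uz.
  exists w; split; first by apply/gp_state_infiniteP.
  move=> w' /(gp_state_infiniteP hn rs _ uz) [hw' w0'].
  exact: (null_infinite_unique rs gs uz hw hw' w0 w0').
move=> w /(gp_state_infiniteP hn rs _ uz) [hw w0].
apply: (pure_of_unique_null hw (x := fun p : nat * 'I_n.-1 =>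
  eigen_defect (_ ^+ p.1 * _ p.2) (z (n.-1 * p.1 + p.2)%N)) w0) => w' hw' w0'.
exact: (null_infinite_unique rs gs uz hw' hw w0' w0).
Qed.
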